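(* Let $p$ be a prime and let $G$ be a finite $p$-group of order $p^n$. Put $d=d(G)$, $\delta=d(G/Z(G))$, $k'=d(\gamma_2G/\gamma_3G)$, and let $|\gamma_2G|=p^k$. Let $r$ and $t$ be non-negative integers such that $\binom{\delta}{2}-k'=\binom{r}{2}+t$ with $0\le t<r$. Then \[|M(G)|\le p^{\frac{1}{2}(d-1)(n+k)-k(d-\delta)-\binom{\delta}{3}+\binom{r}{3}+\binom{t}{2}}.\]
   Context: For a finite group $H$, $d(H)$ denotes the minimal number of generators of $H$; $Z(G)$ is the center of $G$; $\gamma_iG$ is the $i$-th term of the lower central series ($\gamma_1G=G$, $\gamma_{i+1}G=[\gamma_iG,G]$); $M(G)$ is the Schur multiplier of $G$ (i.e. $H_2(G,\mathbb{Z})$). Binomial coefficients satisfy $\binom{a}{b}=0$ when $0\le a<b$. *)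

(* Defs.v *)
From HB Require Import structures.
From mathcomp Require Import all_boot all_order all_algebra all_fingroup all_solvable.
Set Implicit Arguments. Unset Strict Implicit. Unset Printing Implicit Defensive.
Import GRing.Theory Num.Theory.

Definition dgen (gT : finGroupType) (H : {set gT}) : nat :=
  #|[arg min_(A < H | (<<A>> == <<H>>)%g) #|A|]|.

(* Integral bar complex of G with trivial coefficients Z:
   C_n = free abelian group on G^n (functions gT^n -> int supported in G^n). *)
Definition chain1 (gT : finGroupType) := {ffun gT -> int}.
Definition chain2 (gT : finGroupType) := {ffun gT * gT -> int}.
Definition chain3 (gT : finGroupType) := {ffun gT * gT * gT -> int}.

(* d_2 [g|h] = [h] - [gh] + [g] *)
Definition bd2 (gT : finGroupType) (G : {set gT}) (f : chain2 gT) : chain1 gT :=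
  [ffun x => \sum_(g in G) \sum_(h in G)
     f (g, h) * ((x == h)%:R - (x == (g * h)%g)%:R + (x == g)%:R)]%R.

(* d_3 [g|h|k] = [h|k] - [gh|k] + [g|hk] - [g|h] *)
Definition bd3 (gT : finGroupType) (G : {set gT}) (c : chain3 gT) : chain2 gT :=
  [ffun y => \sum_(g in G) \sum_(h in G) \sum_(k in G)
     c (g, h, k) * ((y == (h, k))%:R - (y == ((g * h)%g, k))%:R
                    + (y == (g, (h * k)%g))%:R - (y == (g, h))%:R)]%R.

Definition cycle2 (gT : finGroupType) (G : {set gT}) (z : chain2 gT) : Prop :=
  (forall x : gT * gT, z x != 0%R -> (x.1 \in G) && (x.2 \in G)) /\ bd2 G z = 0%R.

Definition bound2 (gT : finGroupType) (G : {set gT}) (z : chain2 gT) : Prop :=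
  exists c : chain3 gT, z = bd3 G c.

(* |M(G)| = |H_2(G,Z)| = m : there is a complete system of m pairwise
   incongruent representatives of the 2-cycles modulo the 2-boundaries. *)
Definition schur_order (gT : finGroupType) (G : {set gT}) (m : nat) : Prop :=
  exists s : seq (chain2 gT),
    [/\ size s = m, uniq s,
        (forall z, z \in s -> cycle2 G z),
        (forall z w, z \in s -> w \in s -> bound2 G (z - w)%R -> z = w)
      & (forall z, cycle2 G z -> exists2 w, w \in s & bound2 G (z - w)%R)].

(* Main.v *)
(** Let A be the group of integral bar 2-chains modulo boundaries and modulo a
    multiple N of |G|.  The tautological cocycle [g|h] defines a central
    extension E of G by A, and since |G| annihilates H_2(G, Z), the group M(G)
    embeds in the intersection of A with E'.  Hence |M(G)| |G'| <= |E'|.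

    For an arbitrary central extension E of G, the order of E' is bounded along
    the lower central series.  The section E'/L_3(E) is generated by the
    commutators of lifts of a basis of G/G', with orders dividing those of both
    basis elements; this gives the factor p^((d-1)(n-k)/2).  With x_1, .., x_delta
    lifting generators of G/Z(G), each step of order p in a chief series of G
    inside G' contributes at most p^delta to [E', E] = L_3(E), giving p^(k delta).

    The saving comes from the top step, from G' to the preimage of the Frattini
    subgroup of G'/L_3(G): its contribution is generated by the [x_i, x_j, x_l]
    where {i, j} ranges over k' "standard" pairs, chosen greedily with respect to
    the weight 2^i + 2^j.  By the Hall-Witt identity every triple containing a
    standard pair makes one of these generators redundant.  The remaining triples
    are the triangles of the graph of nonstandard pairs, which has
    C(delta,2) - k' = C(r,2) + t edges, hence (Kruskal-Katona) at most
    C(r,3) + C(t,2) triangles. *)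
Require Import Defs.
From HB Require Import structures.
From Stdlib Require Import Classical.
From mathcomp Require Import all_boot all_order all_algebra all_fingroup all_solvable.
From mathcomp Require Import ring zify.
Import GRing.Theory Num.Theory.
Set Implicit Arguments. Unset Strict Implicit. Unset Printing Implicit Defensive.

(** * Triangles in a graph with a given number of edges *)

Definition triangles (V : finType) (F : {set {set V}}) : {set {set V}} :=
  [set T : {set V} | (#|T| == 3) && [forall x in T, T :\ x \in F]].

Lemma bin2D m n : 'C(m + n, 2) = 'C(m, 2) + 'C(n, 2) + m * n.
Proof.
elim: m => [|m IHm]; first by rewrite add0n bin0n mul0n addn0.
by rewrite addSn !binS !bin1 IHm mulSn; lia.
Qed.

Lemma mul_pred_bin2 m : m.+1 * m = 'C(m, 2) * 2 + m * 2.
Proof. by elim: m => // m IHm; rewrite binS bin1; lia. Qed.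

Section Triangles.
Variable V : finType.
Implicit Types (F : {set {set V}}) (v : V).

Definition degree F v := #|[set e in F | v \in e]|.
Definition nbrs F v := [set x | (x != v) && ([set v; x] \in F)].

Lemma sum_degree F : (forall e, e \in F -> #|e| = 2) ->
  \sum_v degree F v = #|F| * 2.
Proof.
move=> F2; transitivity (\sum_v \sum_(e in F | v \in e) 1).
  by apply: eq_bigr => v _; rewrite sum1dep_card.
rewrite (exchange_big_dep (mem F)) /=; last by move=> v e _ /andP[].
rewrite -sum_nat_const.
apply: eq_bigr => e eF; rewrite -(F2 e eF) sum1dep_card.
by apply: eq_card => x; rewrite inE eF.
Qed.

Lemma card_nbrs F v : (forall e, e \in F -> #|e| = 2) -> #|nbrs F v| = degree F v.
Proof.
move=> F2; rewrite /degree -(@card_in_imset _ _ (fun x => [set v; x]) (nbrs F v)).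
  apply: eq_card => e; rewrite inE; apply/imsetP/andP => [[x]|[eF ve]].
    by rewrite inE => /andP[_ xF] ->; rewrite set21.
  have /cards1P[x ex] : #|e :\ v| == 1 by have := F2 _ eF; rewrite (cardsD1 v) ve add1n => -[->].
  have defe : e = [set v; x] by rewrite -(setD1K ve) ex.
  exists x => //; rewrite inE -defe eF andbT.
  by have : x \in e :\ v by [rewrite ex set11]; rewrite !inE => /andP[].
move=> x y; rewrite !inE => /andP[xv _] /andP[yv _] /setP/(_ x).
by rewrite !inE eqxx (negPf xv) /= => /esym/eqP.
Qed.

(** Removing [v] maps the triangles through it injectively to 2-subsets of its neighbourhood. *)
Lemma card_triangles_at F v : (forall e, e \in F -> #|e| = 2) ->
  #|[set T in triangles F | v \in T]| <= 'C(degree F v, 2).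
Proof.
move=> F2; rewrite -(card_nbrs v F2) -cards_draws.
rewrite -(@card_in_imset _ _ (fun T => T :\ v) [set T in triangles F | v \in T]);
  last first.
  move=> S T /setIdP[_ vS] /setIdP[_ vT] ST.
  by rewrite -(setD1K vS) -(setD1K vT) ST.
apply: subset_leq_card; apply/subsetP => S /imsetP[T TFv ->{S}].
move: TFv => /setIdP[/setIdP[/eqP T3 /forall_inP TF] vT].
rewrite inE.
have := T3; rewrite (cardsD1 v) vT add1n => -[->]; rewrite eqxx andbT.
apply/subsetP => x /setD1P[xv xT]; rewrite inE xv /=.
have vxT : [set v; x] \subset T by rewrite subUset !sub1set vT.
have : #|T :\: [set v; x]| == 1.
  by rewrite cardsD (setIidPr vxT) T3 cards2 [v == x]eq_sym xv.
move=> /cards1P[y Ty]; have yT : y \in T.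
  by have : y \in T :\: [set v; x] by [rewrite Ty set11]; case/setDP.
suff -> : [set v; x] = T :\ y by apply: TF.
by rewrite -Ty setDDr setDv set0U; apply/esym/setIidPr.
Qed.

(* The cascade [C(r,2) + t |-> C(r,3) + C(t,2)] is the Kruskal-Katona bound for
   3-sets; deleting a vertex of least positive degree [s] is enough, since
   [s * (s + 1) <= 2 * #|F|] forces [s < r]. *)
Lemma card_triangles F r t : (forall e, e \in F -> #|e| = 2) ->
  #|F| = 'C(r, 2) + t -> t < r -> #|triangles F| <= 'C(r, 3) + 'C(t, 2).
Proof.
have [m] := ubnP #|F|; elim: m F r t => // m IHm F r t ltFm F2 Frt ltr.
have [->|[e0 e0F]] := set_0Vmem F.
  rewrite (_ : triangles set0 = set0) ?cards0 //; apply/setP => T; rewrite !inE.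
  apply/negP => /andP[/eqP T3 /forall_inP T0].
  have /card_gt0P[x xT] : 0 < #|T| by rewrite T3.
  by have := T0 _ xT; rewrite inE.
have /card_gt0P[v0 v0e] : 0 < #|e0| by rewrite F2.
have dv0 : 0 < degree F v0 by apply/card_gt0P; exists e0; rewrite inE e0F.
case: (@arg_minnP _ v0 (fun v => 0 < degree F v) (degree F) dv0) => v dv minv.
set s := degree F v in dv minv.
pose F' := [set e in F | v \notin e].
have cF : #|F| = s + #|F'|.
  rewrite -(cardsID [set e : {set V} | v \in e] F) /s; congr (_ + _).
    by apply: eq_card => e; rewrite !inE.
  by apply: eq_card => e; rewrite !inE andbC.
have F'2 e : e \in F' -> #|e| = 2 by rewrite inE => /andP[/F2].
(* The vertex [v] and its [s] neighbours all have positive degree, hence degree at least [s] by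
   minimality. *)
have les : s.+1 * s <= #|F| * 2.
  rewrite -(sum_degree F2) (bigID (mem (v |: nbrs F v))) /=.
  apply: leq_trans (leq_addr _ _); rewrite {1}/s -(card_nbrs v F2).
  have -> : #|nbrs F v|.+1 = #|v |: nbrs F v| by rewrite cardsU1 inE eqxx.
  rewrite -sum_nat_const; apply: leq_sum => x; rewrite !inE => /predU1P[->//|].
  move=> /andP[xv vxF]; apply: minv; apply/card_gt0P; exists [set v; x].
  by rewrite inE vxF set22.
have ltsr : s < r.
  rewrite ltnNge; apply/negP => lers; move: les; rewrite Frt.
  have : r.+1 * r <= s.+1 * s by rewrite leq_mul.
  by rewrite mul_pred_bin2; lia.
have split : #|triangles F| <= #|triangles F'| + 'C(s, 2).
  rewrite -(cardsID [set T : {set V} | v \in T] (triangles F)) addnC.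
  apply: leq_add; last first.
    apply: leq_trans (card_triangles_at v F2); apply: subset_leq_card.
    by apply/subsetP => T; rewrite !inE.
  apply: subset_leq_card; apply/subsetP => T; rewrite !inE => /and3P[vT -> /forall_inP TF].
  by apply/forall_inP => x xT; rewrite !inE TF // negb_and vT orbT.
apply: leq_trans split _.
(* If [s <= t], deleting [v] keeps [r] and lowers [t] to [t - s]; superadditivity of ['C(_, 2)]
   closes this case. *)
have [lest|ltts] := leqP s t.
  have F'rt : #|F'| = 'C(r, 2) + (t - s) by lia.
  have := IHm F' r (t - s) _ F'2 F'rt _; move=> le; have {}le := le ltac:(lia) ltac:(lia).
  have := bin2D (t - s) s; rewrite subnK // => ->.
  apply: (@leq_trans ('C(r, 3) + 'C(t - s, 2) + 'C(s, 2))); first by rewrite leq_add2r.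
  by rewrite -addnA leq_add2l leq_addr.
(* If [t < s], the cascade of [F'] drops to the predecessor of [r], named [r] from here on. With
   [s = t + u] and [r = s + x], the two sides finally differ by the product [u * x]. *)
case: r Frt ltr ltsr => // r Frt ltr ltsr.
have b r' : 'C(r'.+1, 2) = 'C(r', 2) + r' by rewrite binS bin1.
have F'rt : #|F'| = 'C(r, 2) + (r + t - s) by have := b r; lia.
have := IHm F' r (r + t - s) _ F'2 F'rt _; move=> le; have {}le := le ltac:(lia) ltac:(lia).
have [u def_s] : exists u, s = t + u by exists (s - t); lia.
have [x def_r] : exists x, r = t + u + x by exists (r - s); lia.
have def_a : r + t - s = t + x by lia.
rewrite def_a in le; rewrite binS def_s; apply: leq_trans (leq_add le (leqnn _)) _.
by rewrite -!addnA leq_add2l def_r !bin2D; lia.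
Qed.

End Triangles.

Local Open Scope group_scope.

(** * Generators of the third lower central term *)

(** In an abelian group the generated subgroup is the product of the cyclic groups [<[t i]>]; these
    are split off one at a time. *)
Lemma card_gen_family (gT : finGroupType) (H : {group gT}) (I : finType) (A : {set I})
    (t : I -> gT) (e : I -> nat) :
    abelian H -> (forall i, i \in A -> t i \in H) ->
    (forall i, i \in A -> (#[t i] <= e i)%N) ->
  (#|<<[set t i | i in A]>>| <= \prod_(i in A) e i)%N.
Proof.
move=> abH; have [m] := ubnP #|A|; elim: m A => // m IHm A ltAm tH te.
have [->|[i iA]] := set_0Vmem A; first by rewrite imset0 gen0 cards1 big_set0.
rewrite (big_setD1 i iA) /= -{1}(setD1K iA) imsetU1.
set B := [set t i | i in A :\ i].
have sBH : <<B>> \subset H.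
  by rewrite gen_subG; apply/subsetP => _ /imsetP[j /setD1P[_ jA] ->]; apply: tH.
have sub : <<t i |: B>> \subset <[t i]> * <<B>>.
  have nBt : <<B>> \subset 'N(<[t i]>).
    by apply: subset_trans sBH _; rewrite sub_abelian_norm ?cycle_subG ?tH.
  rewrite -norm_joinEr // gen_subG subUset sub1set -cycle_subG joing_subl.
  by rewrite -gen_subG joing_subr.
apply: leq_trans (subset_leq_card sub) _.
apply: leq_trans (leq_mul (te i iA) (IHm _ _ _ _)).
- by rewrite orderE mul_cardG leq_pmulr ?cardG_gt0.
- by move: ltAm; rewrite (cardsD1 i) iA.
- by move=> j /setD1P[_]; apply: tH.
by move=> j /setD1P[_]; apply: te.
Qed.

(* [t i j l] stands for [x_i, x_j, x_l].  Each triple [T] with a standard pair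
   gives up the generator [T :\ x, x] for one standard [T :\ x]: the Jacobi
   relation rewrites it into the two other generators of [T], and rewriting
   nonstandard ones strictly decreases [2 ^ i + 2 ^ j + 2 ^ l]. *)
Section Elimination.
Variables (gT : finGroupType) (H : {group gT}) (d p : nat).
Variables (t : 'I_d -> 'I_d -> 'I_d -> gT) (std : {set {set 'I_d}}).
Hypotheses (p_gt0 : (p > 0)%N) (abH : abelian H) (tH : forall i j c, t i j c \in H).
Hypothesis t_exp : forall i j c, t i j c ^+ p = 1.
Hypotheses (tii : forall i c, t i i c = 1) (tV : forall i j c, t j i c = (t i j c)^-1).
Hypothesis jacobi : forall i j c, t i j c * t j c i * t c i j = 1.
Hypothesis nonstd : forall i j c, i != j -> [set i; j] \notin std ->
  t i j c \in <<[set t ij.1 ij.2 c | ij in [set ij : 'I_d * 'I_d |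
     ([set ij.1; ij.2] \in std) && (2 ^ ij.1 + 2 ^ ij.2 < 2 ^ i + 2 ^ j)%N]]>>.

(** The ordering of the pair is picked arbitrarily: by [tV] the other choice only inverts the
    generator, so generated subgroups do not change. *)
Let u (qc : {set 'I_d} * 'I_d) : gT :=
  if [pick ij : 'I_d * 'I_d | qc.1 == [set ij.1; ij.2]] is Some ij
  then t ij.1 ij.2 qc.2 else 1.

Let u_t (K : {group gT}) i j c : i != j -> u ([set i; j], c) \in K -> t i j c \in K.
Proof.
rewrite /u /=; case: pickP => [[a b] /= /eqP E ij|/(_ (i, j)) /=]; last by rewrite eqxx.
have aij : a \in [set i; j] by rewrite E set21.
have bij : b \in [set i; j] by rewrite E set22.
have ab : a != b by apply: contraNneq ij => ab; move: (cards2 i j); rewrite E ab cards2 eqxx; case: (i == j).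
move: aij bij ab; rewrite !inE => /pred2P[]-> /pred2P[]->; rewrite ?eqxx // => _.
by rewrite tV groupV.
Qed.

Let elim_vertex (T : {set 'I_d}) := [pick x in T | T :\ x \in std].
Let touched := [set T : {set 'I_d} | (#|T| == 3) && [exists x in T, T :\ x \in std]].
(** The generators given up, exactly one for each touched triple; those in [X] remain. *)
Let Y := [set qc : {set 'I_d} * 'I_d |
  (qc.2 |: qc.1 \in touched) && (qc.2 \notin qc.1) && (elim_vertex (qc.2 |: qc.1) == Some qc.2)].
Let X := setX std [set: 'I_d] :\: Y.
Let K := <<[set u qc | qc in X]>>.

(** Joining [qc.2] to [qc.1] is a bijection onto the touched triples, with [elim_vertex] recovering
    [qc.2] from the triple. *)
Let cardY : #|Y| = #|touched|.
Proof.
rewrite -(@card_in_imset _ _ (fun qc => qc.2 |: qc.1) Y).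
  apply: eq_card => T; apply/imsetP/idP => [[qc]|].
    by rewrite inE => /andP[/andP[+ _] _] ->.
  move=> Tt; move: (Tt); rewrite inE => /andP[_ /exists_inP[y yT Ty]].
  case e: (elim_vertex T) => [x|]; last first.
    by move: e; rewrite /elim_vertex; case: pickP => // /(_ y); rewrite /= yT Ty.
  have /andP[xT _] : (x \in T) && (T :\ x \in std).
    by move: e; rewrite /elim_vertex; case: pickP => // z /= zP [<-].
  exists (T :\ x, x); last by rewrite /= setD1K.
  by rewrite inE /= setD1K // Tt setD11 e eqxx.
move=> [q c] [q' c'] /setIdP[/andP[_ /= nc] /eqP /= ec].
move=> /setIdP[/andP[_ /= nc'] /eqP /= ec'] E.
have cc' : c = c' by move: ec'; rewrite -E ec => -[].
by rewrite -cc' -(setU1K nc) E cc' setU1K.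
Qed.

Let tK i j c : t i j c \in K.
Proof.
have [n] := ubnP (2 ^ i + 2 ^ j + 2 ^ c)%N; elim: n => // n IHn in i j c *.
move=> ltn.
(* A generator of the current weight outside [Y] needs no Jacobi relation: it is in [X] if its pair
   is standard, and otherwise [nonstd] expresses it by generators of smaller weight. *)
have direct (i' j' c' : 'I_d) : (2 ^ i' + 2 ^ j' + 2 ^ c' = 2 ^ i + 2 ^ j + 2 ^ c)%N -> i' != j' ->
    ([set i'; j'], c') \notin Y -> t i' j' c' \in K.
  move=> w ij' nY; have [sij|nij] := boolP ([set i'; j'] \in std).
    by apply: u_t => //; apply: mem_gen; apply: imset_f; rewrite in_setD nY in_setX sij in_setT.
  apply: subsetP (nonstd c' ij' nij); rewrite gen_subG.
  apply/subsetP => _ /imsetP[[a b] /setIdP[_ /= lab] ->].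
  by apply: IHn; lia.
have [->|ij] := eqVneq i j; first by rewrite tii group1.
(* For a generator in [Y], Jacobi leaves the two others of the same triple. Both have the same
   weight but lie outside [Y], so [direct] applies and there is no circularity. *)
have [YY|nY] := boolP (([set i; j], c) \in Y); last exact: direct.
move: (YY); rewrite inE /= => /andP[/andP[_ nc] /eqP ec].
move: (nc); rewrite !inE negb_or => /andP[ci cj].
have -> : t i j c = (t j c i * t c i j)^-1.
  by apply: (mulIg (t j c i * t c i j)); rewrite mulVg mulgA jacobi.
have E1 : i |: [set j; c] = c |: [set i; j].
  by apply/setP => x; rewrite !inE; case: (x == i); case: (x == j); case: (x == c).
have E2 : j |: [set c; i] = c |: [set i; j].
  by apply/setP => x; rewrite !inE; case: (x == i); case: (x == j); case: (x == c).
rewrite groupV groupM //; apply: direct; rewrite 1?[j == c]eq_sym //; try lia.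
  by rewrite inE /= E1 ec !negb_and; apply/orP; right; apply: contraNneq ci => -[->].
by rewrite inE /= E2 ec !negb_and; apply/orP; right; apply: contraNneq cj => -[->].
Qed.

(** Of the [#|std| * d] standard generators, all of order dividing [p], those in [Y] are redundant
    by [tK]. *)
Lemma card_elimination :
  (#|<<[set t ijc.1.1 ijc.1.2 ijc.2 | ijc in [set: 'I_d * 'I_d * 'I_d]]>>| *
     p ^ #|[set T : {set 'I_d} | (#|T| == 3) && [exists x in T, T :\ x \in std]]|
   <= p ^ (#|std| * d))%N.
Proof.
have sYX : Y \subset setX std [set: 'I_d].
  apply/subsetP => -[q c] /setIdP[/andP[_ /= nc]]; rewrite in_setX in_setT andbT /=.
  rewrite /elim_vertex; case: pickP => // x /= /andP[_ xs] /eqP[E].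
  by move: xs; rewrite E setU1K.
have -> : (#|std| * d)%N = (#|X| + #|touched|)%N.
  rewrite -cardY; have := cardsID Y (setX std [set: 'I_d]).
  by rewrite (setIidPr sYX) cardsX cardsT card_ord addnC => <-.
rewrite expnD leq_pmul2r ?expn_gt0 ?p_gt0 //.
apply: leq_trans (subset_leq_card (_ : _ \subset K)) _.
  by rewrite gen_subG; apply/subsetP => _ /imsetP[ijc _ ->].
rewrite -prod_nat_const; apply: (card_gen_family abH) => qc _.
  by rewrite /u; case: pickP.
rewrite dvdn_leq // order_dvdn /u.
by case: pickP => [ij _|_]; rewrite ?t_exp ?expg1n eqxx.
Qed.
End Elimination.

(** Modulo [T] the elements of [A] commute with those of [B], hence so do the generated
    subgroups. *)
Lemma comm_gen_sub (gT : finGroupType) (A B : {set gT}) (T : {group gT}) :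
    A \subset 'N(T) -> B \subset 'N(T) ->
    (forall a b, a \in A -> b \in B -> [~ a, b] \in T) ->
  [~: <<A>>, <<B>>] \subset T.
Proof.
move=> nA nB AB; rewrite -quotient_cents2 ?gen_subG //.
rewrite !quotient_gen // cent_gen gen_subG quotient_cents2 // gen_subG.
by apply/subsetP => _ /imset2P[a b aA bB ->]; apply: AB.
Qed.

(** * Greedy bases of elementary abelian groups *)

Section Greedy.
Variables (gT : finGroupType) (P : {group gT}) (p : nat) (I : finType) (A : {set I}).
Variables (c : I -> gT) (w : I -> nat).
Hypotheses (abP : p.-abelem P) (p_pr : prime p).
Hypotheses (cP : forall i, i \in A -> c i \in P) (w_inj : {in A &, injective w}).

Definition greedy : {set I} :=
  [set i in A | c i \notin <<[set c j | j in [set j in A | w j < w i]]>>].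

(** Induction on [n]: by injectivity at most one index has weight [n], and its element either
    multiplies the span by a new factor of order [p] or already lies in it. Stating this at every
    cutoff shows that a rejected element lies in the span of lighter kept ones. *)
Lemma greedy_gen n :
  <<[set c j | j in [set j in A | w j < n]]>> =
    <<[set c j | j in [set j in greedy | w j < n]]>> /\
  #|<<[set c j | j in [set j in A | w j < n]]>>| = (p ^ #|[set j in greedy | w j < n]|)%N.
Proof.
elim: n => [|n [IHg IHc]].
  have E0 B : [set j in B | w j < 0] = set0 :> {set I} by apply/setP => j; rewrite !inE andbF.
  by rewrite !E0 imset0 gen0 cards1 cards0.
have [/existsP[i /andP[iA /eqP wi]]|/existsPn noi] := boolP [exists i, (i \in A) && (w i == n)].
  have EA : [set j in A | w j < n.+1] = i |: [set j in A | w j < n].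
    apply/setP => j; rewrite !inE ltnS leq_eqVlt -wi andb_orr; congr (_ || _).
    by apply/andP/eqP => [[jA /eqP/w_inj->//]|->].
  have [gi|ngi] := boolP (i \in greedy).
    have EG : [set j in greedy | w j < n.+1] = i |: [set j in greedy | w j < n].
      apply/setP => j; rewrite in_setU in_set1 [LHS]in_set [X in _ || X]in_set.
      rewrite ltnS leq_eqVlt -wi andb_orr; congr (_ || _).
      apply/andP/eqP => [[/setIdP[jA _] /eqP/w_inj->//]|->//].
    rewrite EA EG !imsetU1; split.
      by rewrite -[LHS]joing_idr IHg joing_idr.
    rewrite cardsU1 in_set wi ltnn andbF /= add1n expnS -IHc.
    set H := <<_>> in IHc *.
    have ciH : c i \notin H by move: gi; rewrite inE wi => /andP[].
    have ciP := cP iA.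
    have sHP : H \subset P.
      by rewrite gen_subG; apply/subsetP => _ /imsetP[j /setIdP[jA _] ->]; apply: cP.
    have -> : <<c i |: [set c j | j in [set j in A | w j < n]]>> = <[c i]> * H.
      rewrite -norm_joinEr ?joing_idl ?joing_idr //.
      apply: subset_trans sHP _; rewrite sub_abelian_norm ?cycle_subG //.
      exact: abelem_abelian abP.
    have oci : #[c i] = p.
      by apply: (abelem_order_p abP) => //; apply: contraNneq ciH => ->; apply: group1.
    rewrite TI_cardMg -?orderE ?oci //; apply: prime_TIg; rewrite -?orderE ?oci //.
    by rewrite cycle_subG.
  have EG : [set j in greedy | w j < n.+1] = [set j in greedy | w j < n].
    apply/setP => j; rewrite [LHS]in_set [RHS]in_set ltnS leq_eqVlt -wi andb_orr orbC.
    rewrite orb_idr // => /andP[gj /eqP wj]; case/setIdP: (gj) => jA _.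
    by case/negP: ngi; rewrite -(w_inj jA iA wj).
  have ciH : c i \in <<[set c j | j in [set j in A | w j < n]]>>.
    by move: ngi; rewrite inE iA wi negbK.
  rewrite EA EG imsetU1 -IHg -IHc.
  have -> : <<c i |: [set c j | j in [set j in A | w j < n]]>> =
            <<[set c j | j in [set j in A | w j < n]]>>; last by [].
  apply/eqP; rewrite eqEsubset; apply/andP; split; last by rewrite genS ?subsetUr.
  by rewrite gen_subG subUset sub1set ciH subset_gen.
have E (B : {set I}) : B \subset A -> [set j in B | w j < n.+1] = [set j in B | w j < n] :> {set I}.
  move=> /subsetP sBA; apply/setP => j; rewrite !inE ltnS leq_eqVlt andb_orr orb_idl //.
  by move=> /andP[jB wj]; have := noi j; rewrite sBA ?wj.
by rewrite !E //; apply/subsetP => i /setIdP[].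
Qed.
End Greedy.

(** Uniqueness of binary expansions; the base 2 logarithm of the sum recovers the larger
    exponent. *)
Lemma pair_weight_inj (i j a b : nat) : (i < j)%N -> (a < b)%N ->
  (2 ^ i + 2 ^ j = 2 ^ a + 2 ^ b)%N -> (i, j) = (a, b).
Proof.
move=> ij ab E.
have log m n : (m < n)%N -> trunc_log 2 (2 ^ m + 2 ^ n) = n.
  move=> mn; apply: trunc_log_eq => //; rewrite leq_addl expnS mul2n -addnn ltn_add2r.
  by rewrite ltn_exp2l.
have jb : j = b by rewrite -(log _ _ ij) E log.
by move: E => /eqP; rewrite jb eqn_add2r eqn_exp2l // => /eqP->.
Qed.

(** A 3-set containing no standard pair is a triangle of the graph of nonstandard pairs. *)
Lemma card_touched (V : finType) (std : {set {set V}}) :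
  (forall q, q \in std -> #|q| = 2) ->
  #|[set T : {set V} | (#|T| == 3) && [exists x in T, T :\ x \in std]]| +
    #|triangles ([set q : {set V} | #|q| == 2] :\: std)| = 'C(#|V|, 3).
Proof.
move=> std2; rewrite -card_draws.
rewrite -(cardsID [set T : {set V} | [exists x in T, T :\ x \in std]] [set T : {set V} | #|T| == 3]).
congr (_ + _); apply: eq_card => T; rewrite !inE // andbC.
have [T3|_] := eqVneq #|T| 3; last by rewrite !andbF.
rewrite !andbT negb_exists_in; apply: eq_forallb => x.
have [xT /=|//] := boolP (x \in T).
by rewrite !inE; move: T3; rewrite (cardsD1 x) xT add1n => -[->]; rewrite andbT.
Qed.

(** * Third lower central term of a group of class at most three *)

Section ClassThree.
Variables (gT : finGroupType) (Q L Y : {group gT}) (p d k' : nat) (x : 'I_d -> gT).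
Hypotheses (p_pr : prime p) (xQ : forall i, x i \in Q) (sYQ : Y \subset Q).
Hypotheses (sLZ : L \subset 'Z(Q)) (sL2 : L \subset 'L_2(Q)) (s3L : 'L_3(Q) \subset L).
Hypothesis cYQ : Y \subset 'C('L_2(Q)).
Hypothesis genQ : Q \subset <<[set x i | i in [set: 'I_d]] :|: Y>>.
Hypothesis gen2 :
  'L_2(Q) \subset <<[set [~ x ij.1, x ij.2] | ij in [set: 'I_d * 'I_d]] :|: L>>.
Hypotheses (exp2 : forall y, y \in 'L_2(Q) -> y ^+ p \in L) (ind2 : #|'L_2(Q) : L| = (p ^ k')%N).

Let c i j := [~ x i, x j].
Let t i j l := [~ c i j, x l].

Let c2 i j : c i j \in 'L_2(Q). Proof. by rewrite lcnSn mem_commg ?lcn1. Qed.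

Let s3Z : 'L_3(Q) \subset 'Z(Q). Proof. exact: subset_trans sLZ. Qed.

Let mem3 y z : y \in 'L_2(Q) -> z \in Q -> [~ y, z] \in 'L_3(Q).
Proof. by move=> ? ?; rewrite lcnSn mem_commg. Qed.

Let s2Q : 'L_2(Q) \subset Q. Proof. exact: lcn_sub. Qed.

Let comm3 y z w : y \in 'L_2(Q) -> z \in Q -> w \in Q -> commute [~ y, z] w.
Proof.
move=> y2 zQ wQ; have /setIP[_ /centP] := subsetP s3Z _ (mem3 y2 zQ).
exact.
Qed.

Let commM y y' z : y \in 'L_2(Q) -> y' \in 'L_2(Q) -> z \in Q ->
  [~ y * y', z] = [~ y, z] * [~ y', z].
Proof.
move=> y2 y'2 zQ; rewrite commMgJ (conjg_fixP _) //.
by apply/commgP/comm3 => //; apply: subsetP y'2.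
Qed.

Let commX y z n : y \in 'L_2(Q) -> z \in Q -> [~ y ^+ n, z] = [~ y, z] ^+ n.
Proof.
move=> y2 zQ; apply: commXg; apply/commute_sym/comm3 => //.
exact: subsetP y2.
Qed.

Let commL y z : y \in L -> z \in Q -> [~ y, z] = 1.
Proof.
move=> yL zQ; apply/eqP/commgP; have /setIP[_ /centP] := subsetP sLZ _ yL.
exact.
Qed.

Let tV i j l : t j i l = (t i j l)^-1.
Proof.
rewrite /t -[c j i]invg_comm -/(c i j); apply/eqP.
by rewrite eq_sym eq_invg_mul -commM ?groupV ?mulgV ?comm1g ?c2.
Qed.

(** The Hall-Witt identity. Its conjugations disappear because triple commutators are central, and
    its inverses come out because [[~ a, b] * [~ a, b^-1]] lies in the central subgroup [L]. *)
Let jacobi i j l : t i j l * t j l i * t l i j = 1.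
Proof.
have HW a b e : a \in Q -> b \in Q -> e \in Q -> 
   [~ a, b^-1, e] ^ b = [~ a, b, e]^-1.
  move=> aQ bQ eQ.
  have ab : [~ a, b] \in 'L_2(Q) by rewrite lcnSn mem_commg ?lcn1.
  have abV : [~ a, b^-1] \in 'L_2(Q) by rewrite lcnSn mem_commg ?lcn1 ?groupV.
  rewrite (conjg_fixP _); last by apply/commgP/comm3.
  apply/eqP; rewrite eq_sym eq_invg_mul -commM //.
  have : [~ a, b * b^-1] = 1 by rewrite mulgV commg1.
  rewrite commgMJ conjg_mulR => /(canRL (mulgK _)); rewrite mul1g => E.
  have abL : [~ [~ a, b], b^-1] \in L by rewrite (subsetP s3L) ?mem3 ?groupV.
  suff -> : [~ a, b] * [~ a, b^-1] = [~ [~ a, b], b^-1]^-1 ^ [~ a, b]^-1.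
    rewrite commL // memJ_norm ?groupV //; have /andP[_ /subsetP nLQ] := sub_center_normal sLZ.
    by rewrite nLQ // (subsetP s2Q).
  by rewrite E invMg conjgE invgK mulgA.
have := Hall_Witt_identity (x j) (x i) (x l).
rewrite !HW // -/(c _ _) -!/(t _ _ _) -!tV => E.
have C : commute (t j l i) (t l i j).
  apply: comm3 => //; apply: (subsetP s2Q).
  by apply: (subsetP (lcn_sub_leq _ (leqnSn 2))); apply: mem3.
by rewrite -mulgA C mulgA.
Qed.

Let w (ij : 'I_d * 'I_d) := (2 ^ ij.1 + 2 ^ ij.2)%N.
Let A := [set ij : 'I_d * 'I_d | (ij.1 < ij.2)%N].
Let cb (ij : 'I_d * 'I_d) := coset L (c ij.1 ij.2).
(** Indexes a basis of ['L_2(Q) / L] consisting of commutators; [std] forgets the order in each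
    pair. *)
Let G0 := greedy A cb w.
Let std := [set [set ij.1; ij.2] | ij in G0].

Let nLQ : Q \subset 'N(L).
Proof. by have /andP[] := sub_center_normal sLZ. Qed.

Let nL2 : 'L_2(Q) \subset 'N(L).
Proof. exact: subset_trans nLQ. Qed.

Let ab2 : p.-abelem ('L_2(Q) / L).
Proof.
apply/abelemP => //; split.
  rewrite /abelian quotient_cents2 //; apply: subset_trans (commgS _ s2Q) _.
  by rewrite -lcnSn.
move=> _ /morphimP[y Ny y2 ->]; rewrite -morphX //.
by apply: coset_id; apply: exp2.
Qed.

Let cb2 ij : ij \in A -> cb ij \in 'L_2(Q) / L.
Proof. by move=> _; rewrite mem_quotient. Qed.

Let w_inj : {in A &, injective w}.
Proof.
move=> [i j] [a b]; rewrite !inE /= /w /= => ij ab /(pair_weight_inj ij ab) [ia jb].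
by congr (_, _); apply: val_inj.
Qed.

Let gg := greedy_gen ab2 p_pr cb2 w_inj.

Let sGA : {subset G0 <= A}. Proof. by move=> ij /setIdP[]. Qed.

Let card_std : #|std| = k'.
Proof.
have injs : {in A &, injective (fun ij : 'I_d * 'I_d => [set ij.1; ij.2])}.
  move=> [i j] [a b]; rewrite !inE /= => ij ab E.
  have /set2P ai : a \in [set i; j] by rewrite E set21.
  have /set2P bi : b \in [set i; j] by rewrite E set22.
  case: ai bi ab => -> [] ->; rewrite ?ltnn // => ji.
  by have := ltn_trans ij ji; rewrite ltnn.
rewrite card_in_imset; last by apply: sub_in2 injs.
(* This exceeds every weight, so the cutoff in [greedy_gen] becomes vacuous. *)
pose n := (2 ^ d + 2 ^ d)%N.
have ltwn ij : (w ij < n)%N by rewrite -addnS leq_add ?ltn_exp2l ?leq_exp2l // ltnW.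
have En (B : {set 'I_d * 'I_d}) : [set ij in B | (w ij < n)%N] = B.
  by apply/setP => ij; rewrite inE ltwn andbT.
have [_] := gg n; rewrite !En -/G0 => cG.
apply: (expnI (prime_gt1 p_pr)); rewrite -cG -ind2 -card_quotient //.
congr #|(_ : {set _})|; apply/eqP; rewrite eqEsubset gen_subG; apply/andP; split.
  by apply/subsetP => _ /imsetP[ij ijA ->]; apply: cb2.
have nS : [set [~ x ij.1, x ij.2] | ij in [set: 'I_d * 'I_d]] :|: L \subset 'N(L).
  rewrite subUset normG andbT; apply/subsetP => _ /imsetP[ij _ ->].
  by apply: (subsetP nL2); apply: c2.
apply: subset_trans (quotientS L gen2) _; rewrite quotient_gen // gen_subG.
apply/subsetP => _ /morphimP[y Ny yS ->] /=.
case/setUP: yS => [/imsetP[[i j] _ ->]|yL] /=; last by rewrite /= coset_id.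
case: (ltngtP i j) => [ij|ji|/val_inj->]; last by rewrite commgg morph1.
  by apply: mem_gen; apply/imsetP; exists (i, j); rewrite // inE.
rewrite -invg_comm morphV ?groupV; last by apply: (subsetP nL2); apply: c2.
by apply: mem_gen; apply/imsetP; exists (j, i); rewrite // inE.
Qed.

Let std2 q : q \in std -> #|q| = 2.
Proof.
case/imsetP => [[i j]] /sGA; rewrite inE /= => ij ->; rewrite cards2.
by have -> : i != j by apply: contraTneq ij => ->; rewrite ltnn.
Qed.

Let sK i j l : <<[set t ij.1 ij.2 l | ij in [set ij : 'I_d * 'I_d |
     ([set ij.1; ij.2] \in std) && (2 ^ ij.1 + 2 ^ ij.2 < 2 ^ i + 2 ^ j)%N]]>> \subset 'Z(Q).
Proof.
rewrite gen_subG; apply/subsetP => _ /imsetP[ij _ ->].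
by apply: (subsetP s3Z); apply: mem3.
Qed.

(** Modulo [L], a rejected [c i j] is a product of lighter standard commutators. Commutation with
    [x l] is multiplicative on ['L_2(Q)] and kills [L], so it carries this relation over to the
    triple commutators. *)
Let nonstd i j l : i != j -> [set i; j] \notin std ->
  t i j l \in <<[set t ij.1 ij.2 l | ij in [set ij : 'I_d * 'I_d |
     ([set ij.1; ij.2] \in std) && (2 ^ ij.1 + 2 ^ ij.2 < 2 ^ i + 2 ^ j)%N]]>>.
Proof.
wlog ij : i j / (i < j)%N.
  move=> wl ij nij; case: (ltngtP i j) => [ltij|ltji|/val_inj E]; first exact: wl.
    by rewrite tV groupV addnC; apply: wl => //; rewrite 1?eq_sym // setUC.
  by rewrite E eqxx in ij.
move=> _ nij; set K := <<_>>; have sKZ : K \subset 'Z(Q) by apply: sK.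
have nKQ : Q \subset 'N(K) by have /andP[] := sub_center_normal sKZ.
have nG0 : (i, j) \notin G0 by apply: contra nij => ijG; apply/imsetP; exists (i, j).
have ijA : (i, j) \in A by rewrite inE.
have : cb (i, j) \in <<[set cb ij | ij in [set ij in G0 | (w ij < w (i, j))%N]]>>.
  by have [<- _] := gg (w (i, j)); move: nG0; rewrite inE ijA negbK.
set S := [set ij in G0 | _]; pose C := [set c ij.1 ij.2 | ij in S].
have sC2 : C \subset 'L_2(Q) by apply/subsetP => _ /imsetP[ab _ ->]; apply: c2.
have -> : [set cb ij | ij in S] = C / L.
  rewrite /quotient morphimEsub ?(subset_trans sC2) //.
  by rewrite -imset_comp; apply: eq_imset.
rewrite -quotient_gen ?(subset_trans sC2) // => cC.
have cN : c i j \in 'N(L) by apply: (subsetP nL2).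
have cCL : [set c i j] \subset L * <<C>>.
  by rewrite -quotientSK ?sub1set // quotient_set1 // sub1set.
have {}cCL : c i j \in <<C :|: L>>.
  rewrite sub1set in cCL; apply: subsetP cCL.
  by rewrite mul_subG ?genS ?subsetUl // sub_gen // subsetUr.
have : [~: <<C :|: L>>, <<[set x l]>>] \subset K.
  apply: comm_gen_sub; rewrite ?sub1set ?(subsetP nKQ) //.
    by rewrite subUset (subset_trans sC2) ?(subset_trans s2Q) // (subset_trans sL2) ?(subset_trans s2Q).
  move=> a b aCL /set1P->; case/setUP: aCL => [/imsetP[ab /setIdP[abG abw] ->]|aL].
    apply: mem_gen; apply/imsetP; exists ab => //; rewrite inE abw andbT.
    by apply/imsetP; exists ab.
  by rewrite commL ?group1.
by move/subsetP; apply; rewrite mem_commg // mem_gen // set11.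
Qed.

(** Of the ['C(d, 3)] triples, the touched ones save a factor [p] each by [card_elimination]; the
    others are triangles, bounded by [card_triangles]. *)
Lemma card_lcn3 r s : 'C(d, 2) = (k' + ('C(r, 2) + s))%N -> (s < r)%N ->
  (#|'L_3(Q)| * p ^ 'C(d, 3) <= p ^ (k' * d + 'C(r, 3) + 'C(s, 2)))%N.
Proof.
move=> Cd ltsr; set F := [set q : {set 'I_d} | #|q| == 2] :\: std.
have sstd : std \subset [set q : {set 'I_d} | #|q| == 2].
  by apply/subsetP => q /std2; rewrite inE => ->.
have cF : #|F| = ('C(r, 2) + s)%N.
  by rewrite cardsD (setIidPr sstd) card_draws card_ord card_std Cd addKn.
have F2 q : q \in F -> #|q| = 2 by rewrite 2!inE => /andP[_ /eqP].
have := card_triangles F2 cF ltsr; have := card_touched std2; rewrite card_ord -/F.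
set N := #|_| => <- tri.
have ab3 : abelian 'L_3(Q) by apply: abelianS (center_abelian Q).
have le := card_elimination (prime_gt0 p_pr) ab3 (fun i j l => mem3 (c2 i j) (xQ l))
   _ _ tV jacobi nonstd.
have {}le := le _ _; rewrite -/N card_std in le.
have p0 := prime_gt0 p_pr.
rewrite -addnA !expnD mulnA leq_mul ?leq_pexp2l //; last by rewrite -expnD leq_pexp2l.
apply: leq_trans (le _ _).
- rewrite leq_pmul2r ?expn_gt0 ?p0 // subset_leq_card //.
  set T := <<_>>.
  have sTZ : T \subset 'Z(Q).
    rewrite gen_subG; apply/subsetP => _ /imsetP[ijl _ ->].
    by apply: (subsetP s3Z); apply: mem3.
  have nTQ : Q \subset 'N(T) by have /andP[] := sub_center_normal sTZ.
  (* Only the triple commutators of the [x i] survive, as [L] is central and [Y] centralizes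
     ['L_2(Q)]. *)
  rewrite lcnSn; apply: subset_trans (commgSS gen2 genQ) _; apply: comm_gen_sub.
  + apply: subset_trans nTQ; rewrite subUset (subset_trans sL2) // andbT.
    by apply/subsetP => _ /imsetP[ij _ ->]; apply: (subsetP s2Q); apply: c2.
  + apply: subset_trans nTQ; rewrite subUset sYQ andbT.
    by apply/subsetP => _ /imsetP[i _ ->].
  move=> a b /setUP[/imsetP[[i j] _ ->]|aL] /setUP[/imsetP[l _ ->]|bY] /=.
  + by apply: mem_gen; apply/imsetP; exists (i, j, l); rewrite ?inE.
  + suff -> : [~ [~ x i, x j], b] = 1 by apply: group1.
    by apply/eqP/commgP/commute_sym; apply: (centP (subsetP cYQ _ bY)); apply: c2.
  + by rewrite commL ?group1.
  by rewrite commL ?group1 // (subsetP sYQ).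
- by move=> i j l; rewrite /t -commX // commL // exp2.
by move=> i l; rewrite /t /c commgg comm1g.
Qed.
End ClassThree.

(** * Central extensions *)

Lemma center_norm (gT : finGroupType) (Q T : {group gT}) : T \subset 'Z(Q) -> Q \subset 'N(T).
Proof. by case/sub_center_normal/andP. Qed.

Lemma comm_center (gT : finGroupType) (Q : {group gT}) a b : a \in 'Z(Q) -> b \in Q -> [~ a, b] = 1.
Proof. by case/setIP => _ /centP aZ bQ; apply/eqP/commgP/aZ. Qed.

Lemma comm_center_r (gT : finGroupType) (Q : {group gT}) a b : a \in 'Z(Q) -> b \in Q -> [~ b, a] = 1.
Proof. by move=> aZ bQ; rewrite -invg_comm (comm_center aZ bQ) invg1. Qed.

(** The commutators [[~ c, x i]] generate [[~: K, Q]], since [M] is central and [Y] centralizes [K];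
    their orders divide [p] because [c ^+ p] is central. *)
Lemma card_comm_step (gT : finGroupType) (Q K M Y : {group gT}) p d (x : 'I_d -> gT) c :
    (p > 0)%N -> K \subset Q -> M \subset 'Z(Q) -> Y \subset Q -> (forall i, x i \in Q) ->
    c \in K -> K \subset <<[set c] :|: M>> ->
    Y \subset 'C(K) -> Q \subset <<[set x i | i in [set: 'I_d]] :|: Y>> ->
    [~: K, Q] \subset 'Z(Q) -> c ^+ p \in M ->
  (#|[~: K, Q]| <= p ^ d)%N.
Proof.
move=> p0 sKQ sMZ sYQ xQ cK genK cYK genQ sKQZ cpM.
pose t i := [~ c, x i]; set T := <<[set t i | i in [set: 'I_d]]>>.
have tKQ i : t i \in [~: K, Q] by rewrite mem_commg.
have tZ i : t i \in 'Z(Q) by apply: (subsetP sKQZ).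
have sTZ : T \subset 'Z(Q) by rewrite gen_subG; apply/subsetP => _ /imsetP[i _ ->].
apply: leq_trans (subset_leq_card (_ : _ \subset T)) _.
  apply: subset_trans (commgSS genK genQ) _; have nTQ := center_norm sTZ.
  apply: comm_gen_sub.
  - apply: subset_trans nTQ; rewrite subUset sub1set (subsetP sKQ) //=.
    exact: subset_trans sMZ (center_sub _).
  - apply: subset_trans nTQ; rewrite subUset sYQ andbT.
    by apply/subsetP => _ /imsetP[i _ ->].
  move=> a b /setUP[/set1P->|aM] bxY.
    case/setUP: bxY => [/imsetP[i _ ->]|bY]; first by apply: mem_gen; apply: imset_f.
    have -> : [~ c, b] = 1 by apply/eqP/commgP/commute_sym; apply: (centP (subsetP cYK _ bY)).
    exact: group1.
  rewrite (comm_center (subsetP sMZ _ aM)) //.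
  by case/setUP: bxY => [/imsetP[i _ ->]|/(subsetP sYQ)].
have -> : (p ^ d = \prod_(i in [set: 'I_d]) p)%N by rewrite prod_nat_const cardsT card_ord.
apply: (card_gen_family (center_abelian Q)) => [i _|i _]; first exact: tZ.
rewrite dvdn_leq // order_dvdn -commXg ?(comm_center (subsetP sMZ _ cpM)) //.
have /setIP[_ /centP tc] := tZ i; apply/commute_sym/tc.
exact: subsetP cK.
Qed.

(** The order of [[~ y i, y j]] divides both [q i] and [q j], so its square is at most [q i * q j].
    Over all pairs [i < j], each [q i] occurs [r.-1] times. *)
Lemma card_lcn2 (gT : finGroupType) (Q : {group gT}) r (y : 'I_r -> gT) (q : 'I_r -> nat) :
    'L_2(Q) \subset 'Z(Q) -> (forall i, y i \in Q) -> (forall i, (q i > 0)%N) ->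
    Q \subset <<[set y i | i in [set: 'I_r]] :|: 'Z(Q)>> ->
    (forall i, y i ^+ q i \in 'Z(Q)) ->
  (#|'L_2(Q)| ^ 2 <= (\prod_i q i) ^ r.-1)%N.
Proof.
move=> s2Z yQ q0 genQ yqZ.
pose A := [set ij : 'I_r * 'I_r | (ij.1 < ij.2)%N].
pose t (ij : 'I_r * 'I_r) := [~ y ij.1, y ij.2].
have tZ ij : t ij \in 'Z(Q) by rewrite (subsetP s2Z) // lcnSn mem_commg ?lcn1.
set T := <<[set t ij | ij in A]>>.
have sTZ : T \subset 'Z(Q) by rewrite gen_subG; apply/subsetP => _ /imsetP[i _ ->].
have sQT : 'L_2(Q) \subset T.
  rewrite lcnSn lcn1; apply: subset_trans (commgSS genQ genQ) _.
  have sgQ : [set y i | i in [set: 'I_r]] :|: 'Z(Q) \subset Q.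
    by rewrite subUset center_sub andbT; apply/subsetP => _ /imsetP[i _ ->].
  have sgN := subset_trans sgQ (center_norm sTZ).
  apply: comm_gen_sub => // a b aQ bQ; have [a' b'] := (subsetP sgQ _ aQ, subsetP sgQ _ bQ).
  case/setUP: aQ => [/imsetP[i _ Ea]|aZ]; last by rewrite (comm_center aZ).
  case/setUP: bQ => [/imsetP[j _ Eb]|bZ]; last by rewrite (comm_center_r bZ).
  rewrite Ea Eb; case: (ltngtP i j) => [ij|ji|/val_inj->]; last by rewrite commgg group1.
    by apply: mem_gen; apply/imsetP; exists (i, j); rewrite ?inE.
  by rewrite -invg_comm groupV; apply: mem_gen; apply/imsetP; exists (j, i); rewrite ?inE.
have ot ij : (#[t ij] ^ 2 <= q ij.1 * q ij.2)%N.
  have [/setIP[_ /centP tc]] := tZ ij.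
  rewrite -mulnn; apply: leq_mul; rewrite dvdn_leq // order_dvdn /t.
    by rewrite -commXg ?(comm_center (yqZ _)) //; apply/commute_sym/tc.
  rewrite -commgX ?(comm_center_r (yqZ _)) //; apply/commute_sym/tc => //.
have le : (#|'L_2(Q)| <= \prod_(ij in A) #[t ij])%N.
  apply: leq_trans (subset_leq_card sQT) _.
  by apply: (card_gen_family (center_abelian Q)) => ij _; rewrite ?tZ.
apply: (@leq_trans (\prod_(ij in A) (q ij.1 * q ij.2))).
  rewrite -mulnn; apply: leq_trans (leq_mul le le) _.
  rewrite -big_split /=; apply: leq_prod => ij _; rewrite mulnn; apply: ot.
rewrite big_split /=.
have -> : (\prod_(ij in A) q ij.2 = \prod_(ij : 'I_r * 'I_r | ij.2 < ij.1) q ij.1)%N.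
  rewrite (reindex_inj (h := fun ij : 'I_r * 'I_r => (ij.2, ij.1))) /=; last first.
    by move=> [a b] [a' b'] [-> ->].
  by apply: eq_bigl => ij; rewrite inE.
have -> : (\prod_(ij in A) q ij.1 = \prod_(ij : 'I_r * 'I_r | ij.1 < ij.2) q ij.1)%N.
  by apply: eq_bigl => ij; rewrite inE.
have -> : ((\prod_i q i) ^ r.-1 = \prod_(ij : 'I_r * 'I_r | ij.1 != ij.2) q ij.1)%N.
  rewrite -(pair_big_dep xpredT (fun i j => i != j) (fun i j => q i)) /=.
  rewrite (big_morph (fun m => m ^ r.-1)%N (id1 := 1%N) (op1 := muln)) ?exp1n //; last first.
    by move=> a b; apply: expnMn.
  apply: eq_bigr => i _; rewrite prod_nat_const; congr (_ ^ _)%N.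
  by rewrite -{1}(card_ord r) -(cardC1 i); apply: eq_card => j; rewrite !inE eq_sym.
rewrite [leqRHS](bigID (fun ij : 'I_r * 'I_r => (ij.1 < ij.2)%N)) /=.
apply: leq_mul; rewrite (eq_leq (eq_bigl _ _ _)) //.
  by move=> ij; rewrite -val_eqE /= neq_ltn; case: ltngtP.
by move=> ij; rewrite -val_eqE /= neq_ltn; case: ltngtP.
Qed.

Section CentralExtension.
Variables (eT gT : finGroupType) (E : {group eT}) (G : {group gT}) (f : {morphism E >-> gT}).
Hypotheses (fE : f @* E = G) (kerZ : 'ker f \subset 'Z(E)).

Lemma morphim_cext_lcn n : f @* 'L_n(E) = 'L_n(G).
Proof. by rewrite morphim_lcn // fE. Qed.

(** Intersecting the preimage with ['L_2(E)] keeps it inside the subgroup that [Y] centralizes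
    below; it still maps onto every [K] inside ['L_2(G)]. *)
Definition lift2 (K : {set gT}) := f @*^-1 K :&: 'L_2(E).

Canonical lift2_group (K : {group gT}) := Eval hnf in [group of lift2 K].

Lemma mem_lift2 K y : (y \in lift2 K) = (y \in 'L_2(E)) && (f y \in K).
Proof.
rewrite in_setI andbC; case y2: (y \in 'L_2(E)) => //=.
by apply/morphpreP/idP => [[]|fyK] //; split=> //; apply: subsetP y2; apply: lcn_sub.
Qed.

Lemma lift2_sub K : lift2 K \subset E.
Proof. exact: subset_trans (subsetIr _ _) (lcn_sub 2 E). Qed.

Lemma lift2_normal (K : {group gT}) : K <| G -> lift2 K <| E.
Proof.
case/andP => sKG nKG; rewrite /normal lift2_sub; apply/subsetP => e Ee; rewrite inE.
apply/subsetP => _ /imsetP[y yK ->]; move: yK.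
rewrite !mem_lift2 => /andP[y2 fyK]; have nL := normal_norm (lcn_normal 2 E).
rewrite memJ_norm ?(subsetP nL) // y2 morphJ // ?(subsetP (lcn_sub 2 E) _ y2) //.
by rewrite memJ_norm // (subsetP nKG) // -fE mem_morphim.
Qed.

Lemma morphim_lift2 (K : {group gT}) : K \subset 'L_2(G) -> f @* lift2 K = K.
Proof.
move=> sK2; apply/eqP; rewrite eqEsubset; apply/andP; split.
  by apply/subsetP => _ /morphimP[y Ey + ->]; rewrite mem_lift2 => /andP[].
apply/subsetP => z zK; have := subsetP sK2 z zK; rewrite -morphim_cext_lcn.
by case/morphimP => y Ey y2 Ez; rewrite Ez mem_morphim // mem_lift2 y2 -Ez.
Qed.

(** Both lifts contain all of ['ker f :&: 'L_2(E)], so [f] preserves the index. *)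
Lemma index_lift2 (K M : {group gT}) : M \subset K -> K \subset 'L_2(G) ->
  #|lift2 K : lift2 M| = #|K : M|.
Proof.
move=> sMK sK2; have sM2 := subset_trans sMK sK2.
have sl : lift2 M \subset lift2 K by rewrite setSI ?morphpreS.
rewrite -(index_morphim_ker f sl (lift2_sub K)) !morphim_lift2 //.
suff /eqP-> : #|'ker_(lift2 K) f : lift2 M| == 1%N by rewrite muln1.
rewrite indexg_eq1; apply/subsetP => y /setIP[yK yker]; move: yK.
by rewrite !mem_lift2 => /andP[-> _]; rewrite (mker yker) group1.
Qed.

Section Generators.
Variables (p d : nat) (x : 'I_d -> eT) (Y : {group eT}).
Hypotheses (p_pr : prime p) (pG : p.-group G).
Hypotheses (xE : forall i, x i \in E) (sYE : Y \subset E) (cYE : Y \subset 'C('L_2(E))).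
Hypothesis genE : E \subset <<[set x i | i in [set: 'I_d]] :|: Y>>.

Lemma quotient_gens (T : {group eT}) : T <| E ->
  E / T \subset <<[set coset T (x i) | i in [set: 'I_d]] :|: Y / T>>.
Proof.
case/andP => sTE nTE; apply: subset_trans (quotientS T genE) _.
have sgE : [set x i | i in [set: 'I_d]] :|: Y \subset E.
  by rewrite subUset sYE andbT; apply/subsetP => _ /imsetP[i _ ->].
rewrite quotient_gen ?(subset_trans sgE) //; apply: genS.
rewrite quotientU; apply: setSU; apply/subsetP => _ /morphimP[y Ny /imsetP[i _ ->] ->].
exact: imset_f.
Qed.

(* Descends from [K] to a normal subgroup of [G] of index [p] in [K]; modulo
   [~: lift2 M, E] the group [~: lift2 K, E] is then generated by the [d]
   commutators of one element with the [x i], all of order dividing [p]. *)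
Lemma card_comm_lift2 (K : {group gT}) : K <| G -> K \subset 'L_2(G) ->
  (#|[~: lift2 K, E]| <= #|K| ^ d)%N.
Proof.
have [m] := ubnP #|K|; elim: m K => // m IHm K ltKm nKG sK2.
have [K1|ntK] := eqVneq (K : {set gT}) 1.
  have s1 : lift2 K \subset 'Z(E).
    apply: subset_trans kerZ; apply/subsetP => y; rewrite mem_lift2 K1 => /andP[y2 /set1P fy].
    by apply/kerP; rewrite ?(subsetP (lcn_sub 2 E)).
  suff /commG1P -> : lift2 K \subset 'C(E) by rewrite K1 !cards1 exp1n.
  exact: subset_trans s1 (subsetIr _ _).
have [sKG nG] := andP nKG; have pK : p.-group K := pgroupS sKG pG.
(* Nilpotency of [G] makes this proper; a maximal subgroup of [K] above [[~: K, G]] has index [p]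
   and is normal in [G]. *)
have prK : [~: K, G] \proper K.
  by rewrite (nil_comm_properl (pgroup_nil pG)) // subsetI subxx.
have [M maxM sKM] : exists2 M : {group gT}, maximal M K & [~: K, G] \subset M.
  have [EK|//] := maximal_exists (proper_sub prK).
  by move: prK; rewrite EK properxx.
have iM := p_maximal_index pK maxM; have nMK := p_maximal_normal pK maxM.
have sMK := normal_sub nMK; have [_ [c0 c0K c0M]] := properP (maxgroupp maxM).
have nMG : M <| G.
  rewrite /normal (subset_trans sMK) //= -commg_subl.
  exact: subset_trans (commSg _ sMK) sKM.
have : c0 \in f @* lift2 K by rewrite morphim_lift2.
case/morphimP => c Ec cK Ec0.
set T := [~: lift2 M, E].
have nTE : T <| E.
  by rewrite /normal commg_subr (subset_trans (lift2_sub M)) ?normG ?commg_normr.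
have leM : (#|T| <= #|M| ^ d)%N.
  apply: IHm nMG (subset_trans sMK sK2); rewrite ltnS in ltKm; apply: leq_trans ltKm.
  exact: proper_card (maxgroupp maxM).
have sllK : lift2 M \subset lift2 K by rewrite setSI ?morphpreS.
have sTK : T \subset [~: lift2 K, E] by apply: commSg.
have cpM : c0 ^+ p \in M.
  have Nc0 : c0 \in 'N(M) by apply: (subsetP (normal_norm nMK)).
  apply: coset_idr; rewrite ?groupX // morphX //.
  by rewrite -iM -card_quotient ?normal_norm // expg_cardG ?mem_quotient.
(* The index of [lift2 M] in [lift2 K] is the prime [p], and [c] lies outside [lift2 M]. *)
have genK : lift2 K \subset <<[set c] :|: lift2 M>>.
  set J := <<_>>.
  have sMJ : lift2 M \subset J by rewrite sub_gen ?subsetUr.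
  have sJK : J \subset lift2 K by rewrite gen_subG subUset sub1set cK.
  have := Lagrange_index sJK sMJ; rewrite index_lift2 // iM => iJ.
  have /primeP[_ /(_ #|lift2 K : J|)] := p_pr; rewrite -{1}iJ dvdn_mulr // => /(_ isT).
  case/orP => [|/eqP iJp]; first by rewrite indexg_eq1.
  have : #|J : lift2 M| == 1%N by rewrite -(eqn_pmul2l (prime_gt0 p_pr)) muln1 -{1}iJp iJ.
  rewrite indexg_eq1 => /subsetP/(_ c); rewrite mem_gen ?setU11 // => /(_ isT).
  by rewrite mem_lift2 -Ec0 (negPf c0M) andbF.
have nT := normal_norm nTE.
have sKEM : [~: lift2 K, E] \subset lift2 M.
  apply/subsetP => y yKE; rewrite mem_lift2.
  have y2 : y \in 'L_2(E) by apply: subsetP yKE; rewrite lcnSn lcn1 commSg ?lift2_sub.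
  have yE : y \in E by apply: subsetP y2; apply: lcn_sub.
  rewrite y2; apply: (subsetP sKM); rewrite -fE -(morphim_lift2 sK2).
  by rewrite -morphimR ?lift2_sub // mem_morphim.
have sMZ : lift2 M / T \subset 'Z(E / T).
  rewrite subsetI quotientS ?lift2_sub //= quotient_cents2 ?(subset_trans (lift2_sub M)) //.
have cT : c \in 'N(T) by apply: (subsetP nT).
have step : (#|[~: lift2 K / T, E / T]| <= p ^ d)%N.
  apply: (card_comm_step (prime_gt0 p_pr) _ sMZ (quotientS T sYE) _ (c := coset T c)).
  - exact: quotientS (lift2_sub K).
  - by move=> i; apply: mem_quotient.
  - exact: mem_quotient.
  - apply: subset_trans (quotientS T genK) _.
    rewrite quotient_gen ?quotientU ?quotient_set1 // subUset sub1set cT /=.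
    exact: subset_trans (lift2_sub M) nT.
  - by apply/quotient_cents/(subset_trans cYE)/centS/subsetIr.
  - exact: quotient_gens.
  - rewrite -quotientR ?(subset_trans (lift2_sub K)) //.
    exact: subset_trans (quotientS T sKEM) sMZ.
  rewrite -morphX // mem_quotient // mem_lift2 morphX // -Ec0 cpM andbT groupX //.
  by move: cK; rewrite mem_lift2 => /andP[].
rewrite -(Lagrange sTK) -(Lagrange sMK) iM expnMn leq_mul //.
have sKE : [~: lift2 K, E] \subset E by rewrite commg_subr (subset_trans (lift2_sub K)) ?normG.
by rewrite -card_quotient ?(subset_trans sKE) // quotientR ?(subset_trans (lift2_sub K)).
Qed.

(** With [T] the commutator of [lift2 Lb] and [E], [card_lcn3] bounds ['L_3(E) / T] and
    [card_comm_lift2] bounds [T] by [#|Lb| ^ d]. As [#|Lb|] is [p ^ (k - k')], the two contributions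
    add up to [k * d]. *)
Lemma card_lcn3_cext (Lb : {group gT}) k k' r s :
    f @* Y \subset 'Z(G) -> #|'L_2(G)| = (p ^ k)%N ->
    'L_3(G) \subset Lb -> Lb \subset 'L_2(G) -> (forall z, z \in 'L_2(G) -> z ^+ p \in Lb) ->
    #|'L_2(G) : Lb| = (p ^ k')%N -> 'C(d, 2) = (k' + ('C(r, 2) + s))%N -> (s < r)%N ->
  (#|'L_3(E)| * p ^ 'C(d, 3) <= p ^ (k * d + 'C(r, 3) + 'C(s, 2)))%N.
Proof.
move=> sYZ c2G s3Lb sLb2 expLb iLb Cd ltsr; have p0 := prime_gt0 p_pr.
have s2E := lcn_sub 2 E; have s2G := lcn_sub 2 G.
have nLbG : Lb <| G.
  rewrite /normal (subset_trans sLb2) // -commg_subl.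
  by apply: subset_trans s3Lb; rewrite (lcnSn 1) commSg.
pose L := [group of lift2 Lb]; pose T := [group of [~: L, E]].
have sLE : L \subset E by apply: lift2_sub.
have nTE : T <| E by rewrite /normal commg_subr (subset_trans sLE) ?normG ?commg_normr.
have nT := normal_norm nTE.
have sL2 : L \subset 'L_2(E) by apply: subsetIr.
have s3L : 'L_3(E) \subset L.
  apply/subsetP => y y3; rewrite mem_lift2 (subsetP (lcn_sub_leq _ (leqnSn 2)) _ y3) /=.
  by apply: (subsetP s3Lb); rewrite -morphim_cext_lcn mem_morphim // (subsetP (lcn_sub 3 E)).
have sT3 : T \subset 'L_3(E) by rewrite (lcnSn 1) commSg.
have iL : #|'L_2(E) : L| = (p ^ k')%N.
  rewrite -iLb -(index_lift2 sLb2 (subxx _)); congr #|_ : _|.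
  apply/eqP; rewrite eqEsubset subsetIr andbT; apply/subsetP => y y2.
  by rewrite mem_lift2 y2 /= -morphim_cext_lcn mem_morphim // (subsetP s2E).
have nLE : L <| E by apply: lift2_normal.
have gen2 : 'L_2(E) \subset <<[set [~ x ij.1, x ij.2] | ij in [set: 'I_d * 'I_d]] :|: L>>.
  set J := <<_>>.
  have sLJ : L \subset J by rewrite sub_gen ?subsetUr.
  have c2 i j : [~ x i, x j] \in 'L_2(E) by rewrite lcnSn mem_commg ?lcn1.
  have sJ2 : J \subset 'L_2(E).
    by rewrite gen_subG subUset sL2 andbT; apply/subsetP => _ /imsetP[ij _ ->].
  have nJE : E \subset 'N(J).
    rewrite -commg_subl; apply: subset_trans sLJ; apply: subset_trans s3L.
    by rewrite (lcnSn 1) commSg.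
  have sgE : [set x i | i in [set: 'I_d]] :|: Y \subset E.
    by rewrite subUset sYE andbT; apply/subsetP => _ /imsetP[i _ ->].
  have sgN := subset_trans sgE nJE.
  rewrite lcnSn lcn1; apply: subset_trans (commgSS genE genE) _.
  (* Since [f y] is central, [[~ a, y]] is in the kernel of [f], hence in [L]. *)
  have cEY a y : a \in E -> y \in Y -> [~ a, y] \in J.
    move=> aE yY; have yE := subsetP sYE _ yY.
    apply: (subsetP sLJ); rewrite mem_lift2 lcnSn lcn1 mem_commg //= morphR //.
    have fyZ : f y \in 'Z(G) by rewrite (subsetP sYZ) ?mem_morphim.
    by rewrite (comm_center_r fyZ) ?group1 // -fE mem_morphim.
  apply: comm_gen_sub => // a b aE bE; have [a' b'] := (subsetP sgE _ aE, subsetP sgE _ bE).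
  case/setUP: aE => [/imsetP[i _ Ea]|aY]; last by rewrite -invg_comm groupV cEY.
  case/setUP: bE => [/imsetP[j _ Eb]|bY]; last by rewrite cEY.
  by rewrite Ea Eb; apply: mem_gen; apply/setUP; left; apply/imsetP; exists (i, j).
have q2 : 'L_2(E / T) = 'L_2(E) / T by rewrite [RHS]morphim_lcn.
have q3 : 'L_3(E / T) = 'L_3(E) / T by rewrite [RHS]morphim_lcn.
have q0 : (#|'L_3(E / T)| * p ^ 'C(d, 3) <= p ^ (k' * d + 'C(r, 3) + 'C(s, 2)))%N.
  apply: (@card_lcn3 _ (E / T) (L / T) (Y / T) p d k' (coset T \o x)) => //.
  - by move=> i; apply: mem_quotient.
  - exact: quotientS.
  - by rewrite subsetI quotientS //= quotient_cents2 // (subset_trans sLE).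
  - by rewrite q2 quotientS.
  - by rewrite q3 quotientS.
  - by rewrite q2; apply: quotient_cents.
  - exact: quotient_gens.
  - rewrite q2; apply: subset_trans (quotientS T gen2) _.
    rewrite quotient_gen; last first.
      apply: subset_trans nT; rewrite subUset sLE andbT.
      by apply/subsetP => _ /imsetP[ij _ ->]; rewrite groupR.
    rewrite quotientU; apply: genS; apply: setSU.
    apply/subsetP => _ /morphimP[y Ny /imsetP[ij _ ->] ->].
    by apply/imsetP; exists ij => //; rewrite morphR //= (subsetP nT).
  - rewrite q2 => _ /morphimP[y Ny y2 ->]; rewrite -morphX //.
    rewrite mem_quotient // mem_lift2 groupX //= morphX ?(subsetP s2E) // expLb //.
    by rewrite -morphim_cext_lcn mem_morphim // (subsetP s2E).
  rewrite q2 -iL index_quotient_eq ?(subset_trans s2E) //.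
  by apply: subset_trans (subsetIr _ _) _; apply: subset_trans s3L.
have [kk cLb] : {kk | #|Lb| = (p ^ kk)%N & (kk + k' = k)%N}.
  have pLb : p.-group Lb by apply: pgroupS pG; apply: normal_sub.
  exists (logn p #|Lb|); first exact: card_pgroup.
  apply: (expnI (prime_gt1 p_pr)); rewrite expnD -card_pgroup // -c2G -iLb.
  by rewrite Lagrange.
move=> Ek; have := card_comm_lift2 nLbG sLb2; rewrite cLb -expnM => leT.
rewrite -(Lagrange sT3) -card_quotient ?(subset_trans (lcn_sub 3 E)) // -q3.
rewrite -mulnA -Ek mulnDl -!addnA expnD leq_mul // !addnA; exact: q0.
Qed.

End Generators.

(** Apply [card_lcn2] to [E / 'L_3(E)] with lifts of a basis of [G / 'L_2(G)]: the orders of the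
    basis elements multiply to the index, and their number is at most ['m(G)]. *)
Lemma card_lcn2_cext :
  (#|'L_2(E) : 'L_3(E)| ^ 2 <= #|G : 'L_2(G)| ^ ('m(G)).-1)%N.
Proof.
have s2E := lcn_sub 2 E; have s2G := lcn_sub 2 G.
have nG2 : G \subset 'N('L_2(G)) by apply: normal_norm (lcn_normal _ _).
have nE3 : E \subset 'N('L_3(E)) by apply: normal_norm (lcn_normal _ _).
have abG : abelian (G / 'L_2(G)) by apply: der_abelian 0 G.
have [b defb ordb] := abelian_structure abG.
have sizeb : size b = 'r(G / 'L_2(G)) by rewrite -size_abelian_type // -ordb size_map.
pose r := size b; pose bb (i : 'I_r) := nth 1 b i.
rewrite (big_nth 1) big_mkord in defb.
have genb := bigdprodWY defb; have cardb := bigdprod_card defb.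
have bbG i : bb i \in G / 'L_2(G).
  by rewrite -genb; apply: mem_gen; apply/bigcupP; exists i; rewrite ?cycle_id.
have [y yP] : exists y : 'I_r -> eT, forall i, y i \in E /\ coset 'L_2(G) (f (y i)) = bb i.
  apply: (@fin_all_exists _ _ (fun i e => e \in E /\ coset 'L_2(G) (f e) = bb i)) => i.
  have /morphimP[g Ng + ->] := bbG i.
  by rewrite -{1}fE => /morphimP[e _ Ee ->]; exists e.
have yE i : y i \in E by case: (yP i).
(* The preimage of ['L_2(G)], which becomes central modulo ['L_3(E)]; it contains the power of each
   [y i] by the order of [bb i]. *)
pose Zp := 'ker f <*> 'L_2(E).
have sZp : Zp \subset E by rewrite join_subG s2E andbT subsetIl.
have sZpZ : Zp / 'L_3(E) \subset 'Z(E / 'L_3(E)).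
  rewrite quotientY ?(subset_trans s2E) ?(subset_trans (subsetIl _ _)) // join_subG lcn_central.
  rewrite andbT subsetI quotientS ?subsetIl //= quotient_cents //.
  exact: subset_trans kerZ (subsetIr _ _).
have fZp e : e \in E -> f e \in 'L_2(G) -> e \in Zp.
  move=> Ee; rewrite -morphim_cext_lcn => /morphimP[u Eu u2 feu].
  rewrite -(mulgKV u e) groupM //; last exact: (subsetP (joing_subr _ _)).
  apply: (subsetP (joing_subl _ _)); apply/kerP; rewrite ?groupM ?groupV //.
  by rewrite morphM ?groupV // morphV // feu mulgV.
set J := <<[set y i | i in [set: 'I_r]] :|: Zp>>.
have sgE : [set y i | i in [set: 'I_r]] :|: Zp \subset E.
  by rewrite subUset sZp andbT; apply/subsetP => _ /imsetP[i _ ->].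
have sJE : J \subset E by rewrite gen_subG.
have sZJ : Zp \subset J by rewrite sub_gen ?subsetUr.
have sEJ : E \subset J.
  (* As [J] contains the kernel, the inclusion can be checked on images in [G], and then modulo
     ['L_2(G)]. *)
  have kJ : 'ker f * J = J by apply: mulSGid; apply: subset_trans sZJ; apply: joing_subl.
  rewrite -kJ -(morphimSK f) // fE.
  have s2J : 'L_2(G) \subset f @* J.
    by rewrite -morphim_cext_lcn morphimS //; apply: subset_trans sZJ; apply: joing_subr.
  rewrite -(mulSGid s2J) -quotientSK // -genb gen_subG; apply/bigcupsP => i _.
  rewrite cycle_subG -/(bb i); have [_ <-] := yP i; apply: mem_quotient.
  by rewrite mem_morphim // mem_gen // inE imset_f.
have q2 : 'L_2(E / 'L_3(E)) = 'L_2(E) / 'L_3(E) by rewrite [RHS]morphim_lcn.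
rewrite -card_quotient ?(subset_trans s2E) // -q2.
apply: leq_trans (@card_lcn2 _ _ r (coset 'L_3(E) \o y) (fun i => #[bb i]) _ _ _ _ _) _.
- by rewrite q2; apply: lcn_central.
- by move=> i; apply: mem_quotient.
- by move=> i; apply: order_gt0.
- apply: subset_trans (quotientS _ sEJ) _.
  rewrite quotient_gen ?(subset_trans sgE) // genS // quotientU.
  apply: subset_trans (setUS _ sZpZ) _; apply: setSU.
  apply/subsetP => _ /morphimP[u Nu /imsetP[i _ ->] ->].
  exact: (imset_f (coset 'L_3(E) \o y)).
- move=> i; rewrite /= -morphX ?(subsetP nE3) //; apply: (subsetP sZpZ).
  apply: mem_quotient; apply: fZp; first by rewrite groupX.
  have [_ Ei] := yP i; have fyG : f (y i) \in G by rewrite -fE mem_morphim.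
  rewrite morphX //; apply: coset_idr; rewrite ?groupX ?(subsetP nG2) //.
  by rewrite morphX ?(subsetP nG2) //= Ei expg_order.
rewrite cardb card_quotient // leq_pexp2l ?indexg_gt0 // -!subn1 leq_sub2r // /r sizeb.
by rewrite -grank_abelian // quotient_grank.
Qed.

End CentralExtension.

(** * Order of the derived subgroup of a central extension *)

Lemma dgenE (gT : finGroupType) (H : {group gT}) : dgen H = 'm(H).
Proof. by rewrite /dgen genGid. Qed.

Lemma index_Phi_abelian (gT : finGroupType) (P : {group gT}) (p : nat) :
  p.-group P -> abelian P -> #|P : 'Phi(P)| = (p ^ 'm(P))%N.
Proof.
move=> pP abP; rewrite (Phi_Mho pP abP) grank_abelian // (rank_pgroup pP).
rewrite -p_rank_Ohm1 p_rank_abelem ?Ohm1_abelem //.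
rewrite -card_pgroup ?(pgroupS (Ohm_sub _ _)) //.
apply/eqP; rewrite -(eqn_pmul2l (cardG_gt0 'Mho^1(P))) Lagrange ?Mho_sub //.
by rewrite mulnC mul_card_Ohm_Mho_abelian.
Qed.

(** The two sections are bounded separately. The [x i] lift a minimal generating set of [G / 'Z(G)],
    [Y] is the preimage of ['Z(G)], and [Lb] that of the Frattini subgroup of
    ['L_2(G) / 'L_3(G)]. *)
Lemma card_lcn2_bound (eT gT : finGroupType) (E : {group eT}) (G : {group gT})
    (f : {morphism E >-> gT}) (p n k r s : nat) :
    f @* E = G -> 'ker f \subset 'Z(E) -> prime p ->
    #|G| = (p ^ n)%N -> #|'L_2(G)| = (p ^ k)%N ->
    let delta := 'm(G / 'Z(G)) in
    'C(delta, 2) = ('m('L_2(G) / 'L_3(G)) + ('C(r, 2) + s))%N -> (s < r)%N ->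
  (#|'L_2(E)| ^ 2 * p ^ (2 * 'C(delta, 3)) <=
    p ^ ((n - k) * ('m(G)).-1 + 2 * (k * delta + 'C(r, 3) + 'C(s, 2))))%N.
Proof.
move=> fE kerZ p_pr cG c2G delta Cd ltsr; have p0 := prime_gt0 p_pr.
have pG : p.-group G by rewrite /pgroup cG pnatX pnat_id.
have nGZ : G \subset 'N('Z(G)) by apply: normal_norm (center_normal _).
have [B genB cardB] := grank_witness (G / 'Z(G)).
pose bb (i : 'I_(#|B|)) := enum_val i.
have bbB i : bb i \in B by apply: enum_valP.
have [x xP] : exists x : 'I_(#|B|) -> eT, forall i, x i \in E /\ coset 'Z(G) (f (x i)) = bb i.
  apply: (@fin_all_exists _ _ (fun i e => e \in E /\ coset 'Z(G) (f e) = bb i)) => i.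
  have : bb i \in G / 'Z(G) by rewrite -genB mem_gen.
  case/morphimP => g Ng + ->.
  by rewrite -{1}fE => /morphimP[e _ Ee ->]; exists e.
have xE i : x i \in E by case: (xP i).
pose Y := [group of f @*^-1 'Z(G)].
have sYE : Y \subset E by apply: subsetIl.
have kY : 'ker f \subset Y by apply: morphpreS; apply: sub1G.
have fY : f @* Y = 'Z(G) by rewrite morphpreK // fE center_sub.
(* The image of [[~: Y, E]] is trivial, so it lies in the central kernel; the three subgroup lemma
   then makes [Y] centralize ['L_2(E)]. *)
have YE1 : [~: Y, E, E] = 1.
  apply/commG1P; apply: subset_trans (_ : 'ker f \subset _); last first.
    exact: subset_trans kerZ (subsetIr _ _).
  have sYEE : [~: Y, E] \subset E by rewrite commg_subr (subset_trans sYE) ?normG.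
  rewrite ker_trivg_morphim sYEE /= morphimR // fY fE.
  by rewrite (commG1P _) // subsetIr.
have cYE : Y \subset 'C('L_2(E)).
  rewrite centsC lcnSn lcn1; apply/commG1P.
  by apply: three_subgroup => //; rewrite (commGC E Y).
pose J := <<[set x i | i in [set: 'I_(#|B|)]] :|: Y>>.
have genE : E \subset J.
  have sJE : J \subset E.
    by rewrite gen_subG subUset sYE andbT; apply/subsetP => _ /imsetP[i _ ->].
  have sYJ : Y \subset J by rewrite sub_gen ?subsetUr.
  have kJ : 'ker f * J = J by apply: mulSGid; apply: subset_trans sYJ.
  rewrite -kJ -(morphimSK f) // fE.
  have sZJ : 'Z(G) \subset f @* J by rewrite -fY morphimS.
  rewrite -(mulSGid sZJ) -quotientSK // -genB gen_subG; apply/subsetP => v vB.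
  have -> : v = bb (enum_rank_in vB v) by rewrite /bb enum_rankK_in.
  have [_ <-] := xP (enum_rank_in vB v); apply: mem_quotient.
  by rewrite mem_morphim // mem_gen // inE imset_f.
pose P := ('L_2(G) / 'L_3(G))%G.
have s2G := lcn_sub 2 G; have s32 := lcn_sub_leq G (leqnSn 2).
have nG3 : G \subset 'N('L_3(G)) by apply: normal_norm (lcn_normal _ _).
have n23 : 'L_2(G) \subset 'N('L_3(G)) by apply: subset_trans nG3.
have n32 : 'L_3(G) <| 'L_2(G) by rewrite /normal s32.
have pP : p.-group P by apply: quotient_pgroup; apply: pgroupS pG.
have abP : abelian P.
  by rewrite /abelian quotient_cents2 //=; rewrite (lcnSn 1) commgS.
have [Lb PhiLb s3Lb sLb2] := inv_quotientS n32 (Phi_sub P).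
have iLb : #|'L_2(G) : Lb| = (p ^ 'm(P))%N.
  rewrite -(index_Phi_abelian pP abP) PhiLb index_quotient_eq //.
  by apply: subset_trans s3Lb; apply: subsetIr.
have expLb z : z \in 'L_2(G) -> z ^+ p \in Lb.
  move=> z2; have Nz : z \in 'N('L_3(G)) by apply: (subsetP n23).
  have zP : coset 'L_3(G) z \in P by apply: mem_quotient.
  have := Mho_p_elt 1 zP (mem_p_elt pP zP); rewrite expn1 -(Phi_Mho pP abP) PhiLb.
  rewrite -morphX //= => zpLb.
  have : [set z ^+ p] / 'L_3(G) \subset Lb / 'L_3(G).
    by rewrite quotient_set1 ?groupX // sub1set.
  by rewrite quotientSGK ?sub1set // groupX.
have fYZ : f @* Y \subset 'Z(G) by rewrite fY.
have b3 := card_lcn3_cext fE kerZ p_pr pG xE sYE cYE genE fYZ c2G s3Lb sLb2 expLb iLb.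
rewrite cardB -/delta in b3; have {}b3 := b3 _ _ Cd ltsr.
have b2 := card_lcn2_cext fE kerZ.
have iG : #|G : 'L_2(G)| = (p ^ (n - k))%N.
  have lekn : (k <= n)%N by rewrite -(leq_exp2l _ _ (prime_gt1 p_pr)) -cG -c2G subset_leq_card.
  by rewrite -divgS // cG c2G expnB // prime_gt0.
rewrite iG -expnM in b2.
rewrite -(Lagrange (lcn_sub_leq E (leqnSn 2))) mulnC (mulnC #|_|) expnMn mulnCA.
rewrite expnD leq_mul // mulnC [(2 * 'C(delta, 3))%N]mulnC [(2 * (_ + _))%N]mulnC !expnM -expnMn.
by rewrite leq_exp2r.
Qed.

(** * The extension defined by a 2-cocycle *)

(** The cocycle identity for the trivial action, without normalization; this is the source of the
    corrections by [phi 1 1] below. *)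
Definition cocycle2 (aT gT : finGroupType) (phi : gT -> gT -> aT) :=
  forall g h l, phi h l * phi g (h * l) = phi (g * h) l * phi g h.

(** Commutativity and the cocycle identity are parameters of the type, so that a group structure
    depending on them can be attached to it. *)
Definition twisted (aT gT : finGroupType) (phi : gT -> gT -> aT)
  (aC : @commutative aT aT mulg) (phiP : cocycle2 phi) : predArgType := (aT * gT)%type.

Section Twisted.
Variables (aT gT : finGroupType) (phi : gT -> gT -> aT).
Hypotheses (aC : @commutative aT aT mulg) (phiP : cocycle2 phi).

Local Notation eT := (twisted aC phiP).

Lemma cocycle1g g : phi 1 g = phi 1 1.
Proof. by have := phiP 1 1 g; rewrite !mul1g => /mulgI. Qed.

Lemma cocycleg1 g : phi g 1 = phi 1 1.
Proof. by have := phiP g 1 1; rewrite !mulg1 => /mulIg. Qed.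

Definition twisted_mul (x y : eT) : eT := (x.1 * y.1 * phi x.2 y.2, x.2 * y.2).
Definition twisted_one : eT := ((phi 1 1)^-1, 1).
Definition twisted_inv (x : eT) : eT :=
  (x.1^-1 * (phi x.2^-1 x.2)^-1 * (phi 1 1)^-1, x.2^-1).

HB.instance Definition _ := Finite.on eT.

Fact twisted_mulA : associative twisted_mul.
Proof.
move=> [a g] [b h] [c l]; congr (_, _); rewrite /= ?mulgA //.
rewrite -!mulgA; congr (_ * _); rewrite mulgA (aC (phi g h)) -!mulgA; congr (_ * _).
by rewrite phiP.
Qed.

Fact twisted_mul1 : left_id twisted_one twisted_mul.
Proof. by case=> a g; rewrite /twisted_mul /= cocycle1g mul1g aC mulgA mulgV mul1g. Qed.

Fact twisted_mulV : left_inverse twisted_one twisted_inv twisted_mul.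
Proof.
case=> a g; rewrite /twisted_mul /= mulVg; congr (_, _).
by rewrite aC [_ * a]aC !mulgA mulgK mulgV mul1g.
Qed.

HB.instance Definition _ := Finite_isGroup.Build eT twisted_mulA twisted_mul1 twisted_mulV.

(** The factor [(phi 1 1)^-1] sends 1 to [twisted_one] and makes this a homomorphism. *)
Definition twisted_in (a : aT) : eT := (a * (phi 1 1)^-1, 1).
Definition twisted_sec (g : gT) : eT := (1, g).
Definition twisted_proj (x : eT) : gT := x.2.

Lemma twisted_projM : {in setT &, {morph twisted_proj : x y / x * y}}.
Proof. by []. Qed.
Canonical twisted_proj_morphism := Morphism twisted_projM.

Lemma twisted_inM : {morph twisted_in : a b / a * b}.
Proof.
move=> a b; congr (_, _); rewrite /= ?mulg1 // -!mulgA; congr (_ * _).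
by rewrite mulVg mulg1 aC.
Qed.

Lemma twisted_in_central a x : commute (twisted_in a) x.
Proof.
case: x => b g; congr (_, _); rewrite /= ?mulg1 ?mul1g // cocycle1g cocycleg1.
by rewrite (aC b).
Qed.

Lemma twisted_secM g h : twisted_sec g * twisted_sec h = twisted_in (phi g h) * twisted_sec (g * h).
Proof. by congr (_, _); rewrite /= mul1g // cocycle1g !mulg1 ?mul1g // -mulgA mulVg mulg1. Qed.

Lemma twisted_in_inj : injective twisted_in.
Proof. by move=> a b [/mulIg]. Qed.

Lemma ker_twisted_proj : 'ker twisted_proj = [set twisted_in a | a in [set: aT]].
Proof.
apply/setP => x; apply/idP/imsetP => [/mker|[b _ ->]]; last by apply/kerP; rewrite ?inE.
by case: x => a g /= ->; exists (a * phi 1 1); rewrite ?inE // /twisted_in mulgK.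
Qed.

End Twisted.

Close Scope group_scope.
Local Open Scope ring_scope.

(** * The bar complex and its reduction modulo N *)

Import FinRing.Theory.

Section Bar.
Variables (gT : finGroupType) (G : {group gT}).

Definition coef2 (u : gT * gT) (x : gT) : int :=
  (x == u.2)%:R - (x == (u.1 * u.2)%g)%:R + (x == u.1)%:R.
Definition coef3 (u : gT * gT * gT) (y : gT * gT) : int :=
  (y == (u.1.2, u.2))%:R - (y == ((u.1.1 * u.1.2)%g, u.2))%:R
  + (y == (u.1.1, (u.1.2 * u.2)%g))%:R - (y == u.1)%:R.
Definition inG2 (u : gT * gT) := (u.1 \in G) && (u.2 \in G).
Definition inG3 (u : gT * gT * gT) := inG2 u.1 && (u.2 \in G).

Lemma bd2E f x : bd2 G f x = \sum_(u | inG2 u) f u * coef2 u x.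
Proof.
rewrite ffunE pair_big_dep /=; apply: eq_big => [[g h]|[g h] _] //=.
Qed.

Lemma bd3E c y : bd3 G c y = \sum_(u | inG3 u) c u * coef3 u y.
Proof.
rewrite ffunE; under eq_bigr do rewrite pair_big_dep /=.
rewrite pair_big_dep /= (reindex_onto (fun u => (u.1.1, (u.1.2, u.2)))
  (fun v => (v.1, v.2.1, v.2.2))) /=; last by case=> g [h k].
apply: eq_big => [[[g h] k]|[[g h] k] _] //=.
by rewrite /inG3 /inG2 /= eqxx andbT andbA.
Qed.

Lemma bd2D f g : bd2 G (f + g) = bd2 G f + bd2 G g.
Proof.
apply/ffunP => x; rewrite [RHS]ffunE !bd2E -big_split; apply: eq_bigr => u _.
by rewrite ffunE mulrDl.
Qed.

Lemma bd3D c e : bd3 G (c + e) = bd3 G c + bd3 G e.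
Proof.
apply/ffunP => x; rewrite [RHS]ffunE !bd3E -big_split; apply: eq_bigr => u _.
by rewrite ffunE mulrDl.
Qed.

Lemma bd3N c : bd3 G (- c) = - bd3 G c.
Proof.
apply/ffunP => x; rewrite [RHS]ffunE !bd3E -sumrN; apply: eq_bigr => u _.
by rewrite ffunE mulNr.
Qed.

Lemma bd2Mn f n : bd2 G (f *+ n) = bd2 G f *+ n.
Proof.
elim: n => [|n IHn]; last by rewrite !mulrS bd2D IHn.
by apply/ffunP => x; rewrite bd2E ffunE big1 // => u _; rewrite ffunE mul0r.
Qed.

Lemma bd3Mn c n : bd3 G (c *+ n) = bd3 G c *+ n.
Proof.
elim: n => [|n IHn]; last by rewrite !mulrS bd3D IHn.
by apply/ffunP => x; rewrite bd3E ffunE big1 // => u _; rewrite ffunE mul0r.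
Qed.

Definition basis_chain (I : finType) (u : I) : {ffun I -> int} := [ffun v => (v == u)%:R].

Lemma sum_basis_chain (I : finType) (P : pred I) (u : I) (F : I -> int) :
  P u -> \sum_(v | P v) basis_chain u v * F v = F u.
Proof.
move=> Pu; rewrite (bigD1 u) //= ffunE eqxx mul1r big1 ?addr0 // => v /andP[_ /negPf vu].
by rewrite ffunE vu mul0r.
Qed.

Lemma bd3_basis_chain g h k : g \in G -> h \in G -> k \in G ->
  bd3 G (basis_chain (g, h, k)) =
    basis_chain (h, k) - basis_chain ((g * h)%g, k) + basis_chain (g, (h * k)%g) - basis_chain (g, h).
Proof.
move=> gG hG kG; apply/ffunP => y; rewrite bd3E sum_basis_chain ?/inG3 ?/inG2 /= ?gG ?hG //.
by rewrite !ffunE.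
Qed.

Lemma bd3_supp c y : bd3 G c y != 0 -> inG2 y.
Proof.
apply: contraR => nGy; rewrite bd3E big1 // => -[[g h] k] /andP[/andP[/= gG hG] kG].
have ne u : inG2 u -> (y == u)%:R = 0 :> int.
  by move=> Gu; case: eqP => // E; rewrite E Gu in nGy.
by rewrite /coef3 !ne ?/inG2 /= ?groupM ?gG ?hG //; ring.
Qed.

Lemma bd2_bd3 c : bd2 G (bd3 G c) = 0.
Proof.
apply/ffunP => x; rewrite bd2E [RHS]ffunE.
under eq_bigr do rewrite bd3E big_distrl /=.
rewrite exchange_big big1 //= => -[[g h] k] /andP[/andP[/= gG hG] kG].
under eq_bigr do rewrite -mulrA; rewrite -big_distrr /=.
have one u : inG2 u -> \sum_(v | inG2 v) (v == u)%:R * coef2 v x = coef2 u x.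
  by move=> Gu; rewrite -[RHS](sum_basis_chain (coef2^~ x) Gu); apply: eq_bigr => v _; rewrite ffunE.
have -> : \sum_(v | inG2 v) coef3 (g, h, k) v * coef2 v x =
    coef2 (h, k) x - coef2 ((g * h)%g, k) x + coef2 (g, (h * k)%g) x - coef2 (g, h) x.
  rewrite -!one /inG2 /= ?groupM ?gG ?hG // -!sumrN -!big_split /=.
  by apply: eq_bigr => v _; rewrite /coef3 /=; ring.
by rewrite /coef2 /= mulgA; ring.
Qed.

(* Multiplication by [#|G|] is null-homotopic in positive degree, by summing
   [g|h|x] over the last entry. *)
Lemma bd3_cone (z : chain2 gT) : cycle2 G z ->
  bd3 G [ffun u => z u.1] = - (z *+ #|G|).
Proof.
case=> zG dz; apply/ffunP => -[a b]; rewrite [RHS]ffunE ffunMnE bd3E.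
have -> : \sum_(u | inG3 u) [ffun u0 : gT * gT * gT => z u0.1] u * coef3 u (a, b) =
    \sum_(v | inG2 v) z v * \sum_(x in G) coef3 (v, x) (a, b).
  under [RHS]eq_bigr do rewrite big_distrr /=.
  rewrite pair_big_dep /=; apply: eq_big => [[v x]|[v x] _] //=.
  by rewrite ffunE.
(* After the translation of [x] by [h^-1] in the third term, the first three terms of [coef3] sum to
   [coef2], and the last is repeated [#|G|] times. *)
have coefS v : inG2 v -> \sum_(x in G) coef3 (v, x) (a, b) =
    (b \in G)%:R * coef2 v a - (v == (a, b))%:R *+ #|G|.
  case: v => g h /andP[/= gG hG].
  have one (e : gT) : \sum_(x in G) ((a, b) == (e, x))%:R = (b \in G)%:R * (a == e)%:R :> int.
    case bG: (b \in G); last first.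
      rewrite mul0r big1 // => x xG; case: eqP => // -[_ bx]; by rewrite bx xG in bG.
    rewrite (bigD1 b) //= xpair_eqE eqxx andbT mul1r big1 ?addr0 // => x /andP[_ /negPf xb].
    by rewrite xpair_eqE [b == x]eq_sym xb andbF.
  rewrite /coef3 /coef2 /= !big_split /= !sumrN sumr_const [(g, h) == _]eq_sym !one.
  have -> : \sum_(x in G) ((a, b) == (g, (h * x)%g))%:R = (b \in G)%:R * (a == g)%:R :> int.
    rewrite -one (reindex_inj (mulgI h^-1%g)) /=.
    by apply: eq_big => [x|x _]; rewrite ?groupMl ?groupV // mulKVg.
  by ring.
transitivity (\sum_(v | inG2 v)
    ((b \in G)%:R * (z v * coef2 v a) - z v * (v == (a, b))%:R *+ #|G|)).
  apply: eq_bigr => v Gv; rewrite coefS // mulrBr; congr (_ - _); first exact: mulrCA.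
  exact: mulrnAr.
rewrite sumrB -big_distrr /= -bd2E dz ffunE mulr0 sub0r; congr (- _).
rewrite sumrMnl; congr (_ *+ _); have [Gab|] := boolP (inG2 (a, b)).
  rewrite (bigD1 (a, b)) //= eqxx mulr1 big1 ?addr0 // => v /andP[_ /negPf ->].
  by rewrite mulr0.
move=> nGab; have -> : z (a, b) = 0 by apply/eqP; apply: contraNT nGab => /zG.
by rewrite big1 // => v Gv; case: eqP => [E|_]; rewrite ?mulr0 //; rewrite -E Gv in nGab.
Qed.

End Bar.

(* An alias, because [{ffun I -> 'Z_N}] has no canonical additive group instance. *)
Definition chainN (I : finType) (N : nat) : predArgType := {ffun I -> 'Z_N}.
HB.instance Definition _ I N := GRing.Zmodule.on (chainN I N).
HB.instance Definition _ I N := Finite.on (chainN I N).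
HB.instance Definition _ I N := [finGroupMixin of chainN I N for +%R].

Section ModN.
Variables (gT : finGroupType) (G : {group gT}) (N : nat).
Hypotheses (N_gt1 : (1 < N)%N) (dvdGN : (#|G| %| N)%N).

Definition reduceN (I : finType) (z : {ffun I -> int}) : chainN I N := [ffun y => (z y)%:~R].

Lemma reduceND (I : finType) (z w : {ffun I -> int}) : reduceN (z + w) = reduceN z + reduceN w.
Proof. by apply/ffunP => y; rewrite !ffunE rmorphD. Qed.

Definition bd3_modN (c : chainN (gT * gT * gT)%type N) : chainN (gT * gT)%type N :=
  [ffun y => \sum_(u | inG3 G u) c u * (coef3 u y)%:~R].

Lemma bd3_modND c e : bd3_modN (c + e) = bd3_modN c + bd3_modN e.
Proof.
apply/ffunP => y; rewrite !ffunE -big_split; apply: eq_bigr => u _.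
by rewrite ffunE mulrDl.
Qed.

Lemma reduceN_bd3 c : reduceN (bd3 G c) = bd3_modN (reduceN c).
Proof.
apply/ffunP => y; rewrite [LHS]ffunE [RHS]ffunE bd3E rmorph_sum; apply: eq_bigr => u _.
by rewrite ffunE rmorphM.
Qed.

Definition boundN : {set chainN (gT * gT)%type N} :=
  [set bd3_modN c | c in [set: chainN (gT * gT * gT)%type N]].

Lemma boundN_group_set : group_set boundN.
Proof.
apply/group_setP; split=> [|_ _ /imsetP[c _ ->] /imsetP[e _ ->]].
  apply/imsetP; exists 0; rewrite ?inE //; apply/ffunP => y.
  by rewrite !ffunE big1 // => u _; rewrite ffunE mul0r.
by apply/imsetP; exists (c + e); rewrite ?inE // bd3_modND.
Qed.
Canonical boundN_group := Group boundN_group_set.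

Lemma chainN_norm (x : chainN (gT * gT)%type N) : x \in ('N(boundN))%g.
Proof.
by apply: (subsetP (sub_abelian_norm (zmod_abelian setT) (subsetT _))); rewrite inE.
Qed.

Definition bar_class (z : chain2 gT) : coset_of boundN := coset boundN (reduceN z).

Lemma bar_classD z w : bar_class (z + w) = (bar_class z * bar_class w)%g.
Proof. by rewrite /bar_class reduceND -morphM ?chainN_norm. Qed.

Lemma chainN_mulC : @commutative (coset_of boundN) (coset_of boundN) mulg.
Proof.
move=> x y; case: (cosetP x) => a Na ->; case: (cosetP y) => b Nb ->.
by rewrite -!morphM //; congr (coset _ _); apply: addrC.
Qed.

Lemma bar_class_bound z : bound2 G z -> bar_class z = 1%g.
Proof.
case=> c ->; apply: coset_id; rewrite reduceN_bd3; apply: imset_f; by rewrite inE.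
Qed.

Lemma intr_Zp_eq0 (a : int) : a%:~R = 0 :> 'Z_N -> (N %| a)%Z.
Proof.
have nat0 n : n%:R = 0 :> 'Z_N -> (N %| n)%N.
  by move/(congr1 (@nat_of_ord _)); rewrite val_Zp_nat // => /eqP.
case: a => n; rewrite dvdzE ?NegzE ?rmorphN /= -?pmulrn; first exact: nat0.
by move/eqP; rewrite oppr_eq0 => /eqP/nat0.
Qed.

(** If [z] bounds modulo [N], then [z] differs from an integral boundary by [w *+ N], where [w] is
    again a cycle because the integers are torsion free. As [#|G|] divides [N], [bd3_cone] makes
    [w *+ N] a boundary. *)
Lemma bar_class_eq1_bound z : cycle2 G z -> bar_class z = 1%g -> bound2 G z.
Proof.
move=> [zG dz] /coset_idr; rewrite chainN_norm => /(_ isT)/imsetP[c _ zc].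
pose c' : chain3 gT := [ffun u => (c u : nat)%:Z].
have redc : reduceN c' = c by apply/ffunP => u; rewrite !ffunE /= -pmulrn natr_Zp.
have evalB (a b : chain2 gT) y : (a - b) y = a y - b y by rewrite !ffunE.
have dvdN y : (N %| (z - bd3 G c') y)%Z.
  apply: intr_Zp_eq0; rewrite evalB rmorphB /=.
  have /ffunP/(_ y) : reduceN z = reduceN (bd3 G c') by rewrite reduceN_bd3 redc.
  by rewrite [reduceN _ y]ffunE [reduceN _ y]ffunE => ->; rewrite subrr.
pose w : chain2 gT := [ffun y => ((z - bd3 G c') y %/ N)%Z].
have Nw : w *+ N = z - bd3 G c'.
  by apply/ffunP => y; rewrite ffunMnE ffunE -mulr_natr natz divzK.
have N0 : (N > 0)%N := ltnW N_gt1.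
have [q NE] := dvdnP dvdGN.
have wG : cycle2 G w.
  split=> [y|].
    rewrite ffunE => wy; have : (z - bd3 G c') y != 0.
      by apply: contraNneq wy => ->; rewrite div0z.
    rewrite evalB; have [->|/zG//] := eqVneq (z y) 0.
    by rewrite sub0r oppr_eq0 => /bd3_supp.
  have : bd2 G (w *+ N) = 0.
    by rewrite Nw bd2D -bd3N bd2_bd3 addr0.
  rewrite bd2Mn => E; apply/ffunP => x; move/ffunP/(_ x): E.
  by rewrite ffunMnE [RHS]ffunE => /eqP; rewrite mulrn_eq0 (gtn_eqF N0) => /eqP ->; rewrite ffunE.
exists (c' + (- [ffun u => w u.1]) *+ q).
rewrite bd3D bd3Mn bd3N (bd3_cone wG) opprK -mulrnA mulnC -NE Nw.
by rewrite addrC subrK.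
Qed.
End ModN.

(** * The Schur multiplier inside a derived subgroup *)

Import FiniteModule.

Lemma sum_mulrz_morph (V W : zmodType) (F : V -> W) (I : finType) (P : pred I)
    (v : I -> V) (n : I -> int) :
  {morph F : x y / x + y} -> F (\sum_(i | P i) v i *~ n i) = \sum_(i | P i) F (v i) *~ n i.
Proof.
move=> FD; have F0 : F 0 = 0 by apply: (addrI (F 0)); rewrite -FD !addr0.
have FN x : F (- x) = - F x by apply: (addrI (F x)); rewrite -FD !subrr.
have FM x k : F (x *+ k) = F x *+ k.
  by elim: k => // k IHk; rewrite !mulrS FD IHk.
rewrite (big_morph F FD F0); apply: eq_bigr => i _.
by case: (n i) => k; rewrite ?NegzE ?mulrNz ?FN -!pmulrn FM.
Qed.

Section Cover.
Variables (gT : finGroupType) (G : {group gT}) (N : nat).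

Notation bar_class := (bar_class G N).

(** The arguments are in [subg_of G] because the extension needs a whole group type as its
    quotient. *)
Definition bar_cocycle (g h : subg_of G) : coset_of (boundN G N) := bar_class (basis_chain (val g, val h)).

(** The two sides differ by the class of the boundary of the generator [(g, h, l)]. *)
Lemma bar_cocycleP : cocycle2 bar_cocycle.
Proof.
move=> g h l; rewrite /bar_cocycle -!bar_classD.
set c := basis_chain (val g, val h, val l).
have -> : basis_chain (val h, val l) + basis_chain (val g, val (h * l)%g) =
    bd3 G c + (basis_chain (val (g * h)%g, val l) + basis_chain (val g, val h)).
  rewrite bd3_basis_chain ?subgP //=.
  by apply/ffunP => y; rewrite !ffunE; ring.
by rewrite bar_classD bar_class_bound ?mul1g //; exists c.
Qed.

Definition cover := twisted (@chainN_mulC _ G N) bar_cocycleP.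
HB.instance Definition _ := FinGroup.on cover.

Definition cover_in : coset_of (boundN G N) -> cover :=
  @twisted_in _ _ _ (@chainN_mulC gT G N) bar_cocycleP.
Definition cover_proj (x : cover) : gT := val (@twisted_proj _ _ _ (@chainN_mulC gT G N) bar_cocycleP x).

Lemma cover_projM : {in [set: cover] &, {morph cover_proj : x y / (x * y)%g}}.
Proof. by []. Qed.
Canonical cover_proj_morphism := Morphism cover_projM.

Lemma im_cover_proj : (cover_proj @* [set: cover] = G)%g.
Proof.
apply/setP => g; apply/morphimP/idP => [[x _ _ ->]|gG]; first exact: subgP.
by exists (1%g, subg G g); rewrite ?inE //= /cover_proj /= subgK.
Qed.

Lemma ker_cover_proj : ('ker cover_proj \subset 'Z([set: cover]))%g.
Proof.
apply/subsetP => x /mker /= x1; apply/centerP; split=> [|y _]; first by rewrite inE.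
have : x \in ('ker (@twisted_proj _ _ _ (@chainN_mulC _ G N) bar_cocycleP))%g.
  by apply/kerP; rewrite ?inE //; apply: val_inj.
rewrite ker_twisted_proj => /imsetP[a _ ->]; exact: twisted_in_central.
Qed.

(* In the abelianization, [g|h] becomes [s g + s h - s (g h)] for the section
   [s], so a chain [z] is sent to the pairing of [s] with [bd2 z]. *)
Lemma cycle_cover_der (z : chain2 gT) : cycle2 G z ->
  cover_in (bar_class z) \in ('L_2([set: cover]))%g.
Proof.
case=> zG dz; pose D := ([set: cover] / 'L_2([set: cover]))%G.
have abD : abelian D by apply: der_abelian 0 _.
have nD x : x \in ('N('L_2([set: cover])))%g.
  by apply: (subsetP (normal_norm (lcn_normal 2 [set: cover]))); rewrite inE.
have cD x : coset ('L_2([set: cover]))%g x \in D by apply: mem_quotient; rewrite inE.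
(* Passing to [fmod] writes the abelianization additively, so that it accepts integer
   coefficients. *)
pose sg (x : cover) := fmod abD (coset ('L_2([set: cover]))%g x).
have sgM x y : sg (x * y)%g = sg x + sg y.
  by rewrite /sg morphM ?nD // fmodM ?cD.
suff : sg (cover_in (bar_class z)) = 0.
  by move=> E; have := congr1 val E; rewrite /sg fmodK // => /(coset_idr (nD _)).
pose psi (v : chain2 gT) := sg (cover_in (bar_class v)).
have psiD : {morph psi : v w / v + w}.
  by move=> v w; rewrite /psi bar_classD /cover_in twisted_inM sgM.
pose sec : subg_of G -> cover := @twisted_sec _ _ _ (@chainN_mulC gT G N) bar_cocycleP.
pose tau (g : gT) := sg (sec (subg G g)).
have psi_delta u : inG2 G u -> psi (basis_chain u) = tau u.1 + tau u.2 - tau (u.1 * u.2)%g.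
  case: u => g h /andP[/= gG hG].
  have secM : (sec (subg G g) * sec (subg G h) =
      cover_in (bar_cocycle (subg G g) (subg G h)) * sec (subg G g * subg G h))%g.
    exact: twisted_secM.
  have := congr1 sg secM; rewrite (sgM (sec _) (sec _)) (sgM (cover_in _) (sec _)).
  have -> : (subg G g * subg G h = subg G (g * h))%g.
    by apply: val_inj; rewrite /= !subgK ?groupM.
  have -> : bar_cocycle (subg G g) (subg G h) = bar_class (basis_chain (g, h)).
    by rewrite /bar_cocycle !subgK.
  by rewrite /tau => ->; rewrite addrK.
have defz : z = \sum_(u | inG2 G u) basis_chain u *~ z u.
  apply/ffunP => y; rewrite sum_ffunE.
  have zE u : (basis_chain u *~ z u) y = z u * (y == u)%:R.
    by rewrite ffunMzE ffunE mulrzz mulrC.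
  under eq_bigr do rewrite zE.
  have [Gy|nGy] := boolP (inG2 G y).
    rewrite (bigD1 y) //= eqxx mulr1 big1 ?addr0 // => u /andP[_ /negPf uy].
    by rewrite eq_sym uy mulr0.
  have -> : z y = 0 by apply/eqP; apply: contraNT nGy => /zG.
  by rewrite big1 // => u Gu; case: eqP => [E|_]; rewrite ?mulr0 //; rewrite E Gu in nGy.
rewrite -/(psi z) defz sum_mulrz_morph //.
transitivity (\sum_x tau x *~ bd2 G z x); last first.
  by rewrite dz big1 // => x _; rewrite ffunE mulr0z.
under [RHS]eq_bigr do rewrite bd2E mulrz_sumr.
rewrite exchange_big; apply: eq_bigr => u Gu /=; rewrite psi_delta //.
have one g : \sum_x tau x *~ (x == g)%:R = tau g.
  by rewrite (bigD1 g) //= eqxx big1 ?addr0 // => x /negPf->.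
have -> : \sum_x tau x *~ (z u * coef2 u x) = (\sum_x tau x *~ coef2 u x) *~ z u.
  by rewrite mulrz_suml; apply: eq_bigr => x _; rewrite mulrC mulrzA.
congr (_ *~ _); rewrite /coef2; under [RHS]eq_bigr do rewrite mulrzDr mulrzBr.
rewrite big_split sumrB /= !one.
by rewrite -addrA addrC.
Qed.
End Cover.

Close Scope ring_scope.

(** * Counting homology classes in the kernel of the extension *)

Section Schur.
Variables (gT : finGroupType) (G : {group gT}) (N : nat).
Hypotheses (N_gt1 : (1 < N)%N) (dvdGN : (#|G| %| N)%N).
Local Notation bar_class := (bar_class G N).

Lemma cycle2B (z w : chain2 gT) : cycle2 G z -> cycle2 G w -> cycle2 G (z - w)%R.
Proof.
move=> [zG dz] [wG dw]; split=> [y|]; last first.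
  by have := bd2D G (z - w)%R w; rewrite subrK dz dw addr0.
rewrite !ffunE; have [->|/zG//] := eqVneq (z y) 0%R.
by rewrite sub0r oppr_eq0 => /wG.
Qed.

Lemma eq_bar_class_bound (z w : chain2 gT) : cycle2 G z -> cycle2 G w ->
  bar_class z = bar_class w <-> bound2 G (z - w)%R.
Proof.
move=> cz cw; have E : (bar_class (z - w)%R * bar_class w)%g = bar_class z by rewrite -bar_classD subrK.
split=> [zw|/bar_class_bound b]; last by rewrite -E b mul1g.
apply: (bar_class_eq1_bound N_gt1 dvdGN (cycle2B cz cw)).
by apply: (mulIg (bar_class w)); rewrite E mul1g.
Qed.

(** The classes form a finite group, but whether a class comes from an integral cycle is settled by
    excluded middle, one class at a time. *)
Lemma bar_class_representatives (ts : seq (coset_of (boundN G N))) : uniq ts ->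
  exists s : seq (chain2 gT), [/\ forall z, z \in s -> cycle2 G z,
    uniq (map bar_class s), {subset map bar_class s <= ts} &
    forall z, cycle2 G z -> bar_class z \in ts -> bar_class z \in map bar_class s].
Proof.
elim: ts => [_|t ts IHts /= /andP[nt /IHts[s [sC us sub cov]]]]; first by exists [::].
have [[z [cz clz]]|no] := classic (exists z, cycle2 G z /\ bar_class z = t).
  exists (z :: s); split=> [w|||w cw] /=.
  - by rewrite inE => /predU1P[->|/sC].
  - by rewrite us clz andbT; apply: contra nt => /sub.
  - by move=> a; rewrite !inE clz => /predU1P[->|/sub->]; rewrite ?eqxx ?orbT.
  by rewrite !inE clz => /predU1P[->|/(cov _ cw)->]; rewrite ?eqxx ?orbT.
exists s; split=> // [a /sub|w cw]; first by rewrite inE orbC => ->.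
rewrite inE => /predU1P[clw|]; last exact: cov.
by case: no; exists w.
Qed.

(** The classes of cycles embed in the kernel of the surjection from ['L_2([set: cover G N])] onto
    ['L_2(G)]. *)
Lemma schur_order_cover : exists m, schur_order G m /\
  (m * #|('L_2(G))%g| <= #|('L_2([set: cover G N]))%g|)%N.
Proof.
have [s [sC us _ cov]] := bar_class_representatives (enum_uniq [set: coset_of (boundN G N)]).
have cls_inj : {in s &, injective bar_class}.
  move=> z w zs ws E; have ltz : (index z s < size s)%N by rewrite index_mem.
  have ltw : (index w s < size s)%N by rewrite index_mem.
  rewrite -(nth_index z zs) -(nth_index z ws); congr (nth _ _ _); apply/eqP.
  rewrite -(nth_uniq 1%g _ _ us) ?size_map //.
  by rewrite !(nth_map z) // !nth_index // E.
exists (size s); split.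
  exists s; split=> // [|z w zs ws /eq_bar_class_bound E|z cz].
  - exact: map_uniq us.
  - by apply: cls_inj => //; apply: E; apply: sC.
  have /mapP[w ws E] : bar_class z \in map bar_class s by rewrite cov // mem_enum inE.
  by exists w => //; apply/(eq_bar_class_bound cz (sC w ws)).
pose f := [morphism of @cover_proj gT G N].
have im2 : ('L_2(G) = f @* 'L_2([set: cover G N]))%g.
  by rewrite morphim_lcn // im_cover_proj.
pose S := [set cover_in a | a in map bar_class s].
have sS : S \subset ('ker_('L_2([set: cover G N])) f)%g.
  apply/subsetP => _ /imsetP[_ /mapP[z zs ->] ->]; rewrite inE cycle_cover_der //=; last exact: sC.
  by apply/kerP; rewrite ?inE.
have cS : #|S| = size s.
  rewrite card_imset; last exact: twisted_in_inj.
  by rewrite (card_uniqP us) size_map.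
rewrite im2 card_morphim setTI -(LagrangeI 'L_2([set: cover G N]) ('ker f)).
by rewrite leq_mul // -cS subset_leq_card.
Qed.
End Schur.

(* |M(G)| <= p^E  is stated as  |M(G)|^2 <= p^(2E)  (E may be a half-integer). *)
Theorem theorem3p3 (gT : finGroupType) (G : {group gT}) (p n k r t : nat) :
  prime p -> #|G| = (p ^ n)%N -> #|('L_2(G))%g| = (p ^ k)%N ->
  let d := dgen G in
  let delta := dgen (G / 'Z(G))%g in
  let k' := dgen ('L_2(G) / 'L_3(G))%g in
  (('C(delta, 2))%:Z - k'%:Z = ('C(r, 2) + t)%N%:Z)%R -> (t < r)%N ->
  exists m : nat, schur_order G m /\
    (((m ^ 2)%N%:R : rat) <= (p%:R : rat) ^
       ((d%:Z - 1) * (n + k)%N%:Z - 2 * k%:Z * (d%:Z - delta%:Z)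
        - 2 * ('C(delta, 3))%:Z + 2 * ('C(r, 3))%:Z + 2 * ('C(t, 2))%:Z))%R.
Proof.
(* The factor 2 ensures [1 < N] even for trivial [G]. *)
move=> p_pr cG c2 d delta k' Cd ltr; pose N := (2 * #|G|)%N.
have N_gt1 : (1 < N)%N by rewrite /N mul2n -addnn (leq_add (cardG_gt0 G) (cardG_gt0 G)).
have [m [schur_m le_m]] := schur_order_cover N_gt1 (dvdn_mull 2 (dvdnn _)).
exists m; split=> //.
have Ed : d = 'm(G)%g by apply: dgenE.
have Edelta : delta = 'm(G / 'Z(G))%g by apply: dgenE.
have Ek' : k' = 'm('L_2(G) / 'L_3(G))%g by apply: dgenE.
have {}Cd : 'C('m(G / 'Z(G))%g, 2) = ('m('L_2(G) / 'L_3(G))%g + ('C(r, 2) + t))%N.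
  by rewrite -Edelta -Ek'; lia.
have b := card_lcn2_bound (im_cover_proj G N) (ker_cover_proj G N) p_pr cG c2 Cd ltr.
rewrite -Ed -Edelta in b.
have lekn : (k <= n)%N.
  by rewrite -(leq_exp2l _ _ (prime_gt1 p_pr)) -cG -c2 subset_leq_card ?lcn_sub.
have p0 := prime_gt0 p_pr.
have {}b : (m ^ 2 * p ^ (2 * k + 2 * 'C(delta, 3)) <=
    p ^ ((n - k) * d.-1 + 2 * (k * delta + 'C(r, 3) + 'C(t, 2))))%N.
  apply: leq_trans b; rewrite expnD mulnA leq_mul2r; apply/orP; right.
  by rewrite mulnC [(2 * k)%N]mulnC expnM -expnMn mulnC leq_exp2r // -c2.
(* For [d = 0] the truncated [d.-1] is 0 and not -1, but then [G] is trivial and the discrepancy is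
   multiplied by 0. *)
have d0 : d = 0 -> n = 0.
  move=> d0; have [B genB cB] := grank_witness G.
  have B0 : B = set0 by apply: cards0_eq; rewrite cB -Ed.
  have : (1 ^ 1 = p ^ n)%N by rewrite -cG -genB B0 gen0 cards1.
  by move=> /esym/eqP; rewrite exp1n -(expn0 p) eqn_exp2l ?prime_gt1 // => /eqP.
set e := (X in (_ ^ X)%R).
(* Uses [(n - k) * (d - 1) = (n + k) * (d - 1) - 2 * k * (d - 1)]; the final [2 * k] comes from
   dividing by the square of [#|'L_2(G)|]. *)
have -> : e = (((n - k) * d.-1 + 2 * (k * delta + 'C(r, 3) + 'C(t, 2)))%N%:Z -
               (2 * k + 2 * 'C(delta, 3))%N%:Z)%R.
  rewrite /e; case: (d) d0 => [/(_ erefl) n0|d' _].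
    have k0 : k = 0%N by lia.
    by rewrite n0 k0; lia.
  have [u ->] : exists u, n = (k + u)%N by exists (n - k)%N; lia.
  by rewrite addKn /=; lia.
have pQ0 : (p%:R : rat)%R != 0%R by rewrite pnatr_eq0 -lt0n.
rewrite expfzDr // -exprnN -exprnP ler_pdivlMr ?exprn_gt0 ?ltr0n //.
by rewrite -!natrX -natrM ler_nat.
Qed.
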